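(* Let $B$ denote the closed unit ball in $\mathbb{R}^d$. If $f$ is a measurable function satisfying $f\in L\log\log L(B)$ and $\int_B f(y)\,dy=0$, then $f\in H^{\log}(\mathbb{R}^d)$.
   Context: For a measurable set $B\subseteq\mathbb{R}^d$, $L\log\log L(B)$ is the class of all locally integrable functions $f$ on $\mathbb{R}^d$ with $\mathrm{supp}(f)\subseteq B$ and $\int_B |f(x)|\log^+\log^+|f(x)|\,dx<\infty$, where $\log^+ |x| = \max\{\log |x|,0\}$ (and $\log^+ 0=0$). Let $\Psi(x,t) := \dfrac{t}{\log(e+t)+\log(e+|x|)}$ for $(x,t)\in\mathbb{R}^d\times[0,\infty)$, with the convention $\Psi(x,\infty)=\infty$. Fix a non-negative function $\phi\in C^\infty(\mathbb{R}^d)$, supported in the unit ball of $\mathbb{R}^d$, with $\int_{\mathbb{R}^d}\phi(y)\,dy=1$ and $\phi(x)=c_0$ for all $|x|\le 1/2$, where $c_0$ is a constant. For $\epsilon>0$ put $\phi_\epsilon(x):=\epsilon^{-d}\phi(\epsilon^{-1}x)$, and for a tempered distribution $f$ let $M_\phi(f)(x):=\sup_{\epsilon>0}|(f*\phi_\epsilon)(x)|$, $x\in\mathbb{R}^d$. The Hardy space $H^{\log}(\mathbb{R}^d)$ is the space of tempered distributions $f$ on $\mathbb{R}^d$ such that $\int_{\mathbb{R}^d}\Psi(x,M_\phi(f)(x))\,dx<\infty$. *)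

(* Defs.v *)
From HB Require Import structures.
From mathcomp Require Import all_boot all_order all_algebra.
From mathcomp Require Import all_classical all_reals all_analysis.
From mathcomp Require Import complex.

Set Implicit Arguments.
Unset Strict Implicit.
Unset Printing Implicit Defensive.
Import Order.TTheory GRing.Theory Num.Theory.
Import numFieldNormedType.Exports.

Local Open Scope classical_set_scope.
Local Open Scope ring_scope.

(* Product sigma-algebra of the Borel sets of R, i.e. the Borel sets of R^n. *)
Section rV_measurable.
Variables (R : realType) (n : nat).

Let coord (i : 'I_n) (x : 'rV[R]_n) : R := x ord0 i.

Let rV_set0 : g_sigma_preimage coord set0.
Proof. exact: sigma_algebra0. Qed.

Let rV_setC A : g_sigma_preimage coord A -> g_sigma_preimage coord (~` A).
Proof. exact: sigma_algebraC. Qed.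

Let rV_bigcup (F : (set 'rV[R]_n)^nat) :
  (forall i, g_sigma_preimage coord (F i)) ->
  g_sigma_preimage coord (\bigcup_i (F i)).
Proof. exact: sigma_algebra_bigcup. Qed.

HB.instance Definition _ := @isMeasurable.Build default_measure_display
  'rV[R]_n (g_sigma_preimage coord) rV_set0 rV_setC rV_bigcup.

End rV_measurable.

Definition rV_snoc (R : realType) n (p : 'rV[R]_n * measurableTypeR R) : 'rV[R]_n.+1 :=
  \row_i (if unlift ord_max i is Some j then p.1 ord0 j else p.2).

Lemma measurable_rV_coord (R : realType) n (i : 'I_n) :
  measurable_fun [set: 'rV[R]_n] (fun x : 'rV[R]_n => x ord0 i).
Proof.
move=> _ Y mY; rewrite setTI; apply: sub_sigma_algebra => /=.
rewrite -bigcup_seq/=; exists i => /=; first by rewrite mem_index_enum.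
by exists Y => //; rewrite setTI.
Qed.

Lemma measurable_rV_snoc (R : realType) n :
  measurable_fun [set: ('rV[R]_n * measurableTypeR R)%type] (@rV_snoc R n).
Proof.
move=> _ A mA.
pose g (i : 'I_n.+1) (x : 'rV[R]_n.+1) : R := x ord0 i.
have : preimage_set_system setT (@rV_snoc R n) (g_sigma_preimage g)
    (setT `&` @rV_snoc R n @^-1` A) by exists A.
rewrite -g_sigma_preimage_comp; apply: smallest_sub.
  exact: sigma_algebra_measurable.
rewrite -bigcup_seq => B [i _ [Y mY <-]].
suff : measurable_fun setT (g i \o @rV_snoc R n) by exact.
have -> : g i \o @rV_snoc R n =
    (fun p => if unlift ord_max i is Some j then p.1 ord0 j else p.2).
  by apply/funext => p; rewrite /g /= mxE.
case: (unlift _ _) => [j|]; last exact: measurable_snd.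
exact: (measurableT_comp (measurable_rV_coord j) measurable_fst).
Qed.


(* Lebesgue measure on the Borel sets of R^n, as the iterated product of the
   one-dimensional one; the successor case is
   pushforward (borel_lebesgue_rV R m \x lebesgue_measure) rV_snoc, referred to
   by the name of its measure instance, whose measurability argument cannot be
   inferred. *)
Fixpoint borel_lebesgue_rV (R : realType) n :
    {measure set 'rV[R]_n -> \bar R} :=
  match n with
  | 0 => dirac (0 : 'rV[R]_0)
  | m.+1 => measure_function_pushforward__canonical__measure_function_Measure
     (borel_lebesgue_rV R m \x (@lebesgue_measure R))%E (@measurable_rV_snoc R m)
  end.

Section euclidean.
Variables (R : realType) (d : nat).
Local Notation Rd := 'rV[R]_d.
Local Notation C := R[i].

(* R^d with the Lebesgue-measurable sets (the completed sigma-algebra). *)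
Definition lebesgue_space := caratheodory_type ((borel_lebesgue_rV R d)^*)%mu.
HB.instance Definition _ := Measurable.on lebesgue_space.

Definition lebesgue_rV : set lebesgue_space -> \bar R :=
  @completed_measure_extension _ _ _ (borel_lebesgue_rV R d).
HB.instance Definition _ := Measure.on lebesgue_rV.

Local Notation mu := lebesgue_rV.

(* The norm the library puts on 'rV is the sup norm. *)
Definition enorm (x : Rd) : R := Num.sqrt (\sum_i x ord0 i ^+ 2).

Definition unit_ball : set Rd := [set x | enorm x <= 1].

Definition cmeasurable (f : Rd -> C) : Prop :=
  measurable_fun [set: lebesgue_space] (fun x => complex.Re (f x)) /\
  measurable_fun [set: lebesgue_space] (fun x => complex.Im (f x)).

Definition cintegral (D : set Rd) (f : Rd -> C) : C :=
  Complex (\int[mu]_(x in D) complex.Re (f x))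
          (\int[mu]_(x in D) complex.Im (f x)).

Definition loc_integrable (f : Rd -> C) : Prop :=
  cmeasurable f /\
  forall K : set Rd, compact K ->
    (\int[mu]_(x in K) (Normc.normc (f x))%:E < +oo)%E.

(* Complement of the largest open set on which f vanishes almost everywhere. *)
Definition ess_supp (f : Rd -> C) : set Rd :=
  [set x | forall U : set Rd, open U -> U x ->
     ~ mu.-negligible (U `&` [set y | f y != 0])].

Definition lnp (t : R) : R := Num.max (ln t) 0.

Definition LloglogL (B : set Rd) : set (Rd -> C) :=
  [set f | [/\ loc_integrable f, ess_supp f `<=` B &
    (\int[mu]_(x in B)
       (Normc.normc (f x) * lnp (lnp (Normc.normc (f x))))%:E < +oo)%E]].

(* Iterated partial derivatives and monomials are indexed by words of
   coordinates; for smooth functions this is the same as multi-indices. *)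
Definition pderiv (s : seq 'I_d) (u : Rd -> R) : Rd -> R :=
  foldr (fun i g => 'D_(delta_mx 0 i : Rd) g) u s.

Definition monomial (a : seq 'I_d) (x : Rd) : R := \prod_(i <- a) x ord0 i.

Definition smooth (u : Rd -> R) : Prop :=
  forall s : seq 'I_d, continuous (pderiv s u) /\
    forall (i : 'I_d) (x : Rd), derivable (pderiv s u) x (delta_mx 0 i : Rd).

Definition csmooth (u : Rd -> C) : Prop :=
  smooth (fun x => complex.Re (u x)) /\ smooth (fun x => complex.Im (u x)).

Definition cpderiv (s : seq 'I_d) (u : Rd -> C) (x : Rd) : C :=
  Complex (pderiv s (fun y => complex.Re (u y)) x)
          (pderiv s (fun y => complex.Im (u y)) x).

Definition schwartz_seminorm (a s : seq 'I_d) (u : Rd -> C) : \bar R :=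
  ereal_sup
    (range (fun x => (`|monomial a x| * Normc.normc (cpderiv s u x))%:E)).

Definition schwartz : set (Rd -> C) :=
  [set u | csmooth u /\ forall a s, (schwartz_seminorm a s u < +oo)%E].

Definition schwartz_cvg (u_ : nat -> Rd -> C) (u : Rd -> C) : Prop :=
  forall a s, schwartz_seminorm a s (fun x => u_ k x - u x) @[k --> \oo]
    --> (0%E : \bar R).

(* Continuous linear functionals on the (metrizable) Schwartz space; the values
   of T outside the Schwartz space are irrelevant. *)
Definition tempered (T : (Rd -> C) -> C) : Prop :=
  (forall (c : C) (u v : Rd -> C), schwartz u -> schwartz v ->
     T (fun x => c * u x + v x) = c * T u + T v) /\
  (forall (u_ : nat -> Rd -> C) (u : Rd -> C),
     (forall k, schwartz (u_ k)) -> schwartz u -> schwartz_cvg u_ u ->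
     Normc.normc (T (u_ k) - T u) @[k --> \oo] --> (0 : R)).

Definition distribution_of (f : Rd -> C) : (Rd -> C) -> C :=
  fun u => cintegral setT (fun y => f y * u y).

Definition dilate (phi : Rd -> R) (eps : R) (x : Rd) : R :=
  eps ^- d * phi (eps^-1 *: x).

Definition convolution (T : (Rd -> C) -> C) (psi : Rd -> R) (x : Rd) : C :=
  T (fun y => Complex (psi (x - y)) 0).

Definition maximal (phi : Rd -> R) (T : (Rd -> C) -> C) (x : Rd) : \bar R :=
  ereal_sup [set (Normc.normc (convolution T (dilate phi eps) x))%:E |
             eps in [set e : R | 0 < e]].

(* Only evaluated at t >= 0; the value at -oo is a placeholder. *)
Definition Psi (x : Rd) (t : \bar R) : \bar R :=
  match t with
  | t%:E => (t / (ln (expR 1 + t) + ln (expR 1 + enorm x)))%:E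
  | +oo => +oo
  | -oo => 0
  end%E.

Definition Hlog (phi : Rd -> R) : set ((Rd -> C) -> C) :=
  [set T | tempered T /\ (\int[mu]_x Psi x (maximal phi T x) < +oo)%E].

End euclidean.

(* Main.v *)
Require Import Defs.
From mathcomp Require Import all_boot all_order all_algebra.
From mathcomp Require Import all_classical all_reals all_analysis.
From mathcomp Require Import complex.
From mathcomp Require Import measurable_realfun ring lra.
Set Implicit Arguments.
Unset Strict Implicit.
Unset Printing Implicit Defensive.
Import Order.TTheory GRing.Theory Num.Theory.
Import numFieldNormedType.Exports.
Local Open Scope classical_set_scope.
Local Open Scope ring_scope.

(* Write M for the maximal function of f and g = |f|; cubes are balls of the sup
   norm.  Psi(x, M) is estimated separately near to and far from the ball.

   Far away, the cancellation of f and the Lipschitz bound on phi give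
   M(x) = O(|x|^-(d+1)), which is integrable.

   Near the ball, M(x) > 2^k forces x into the union F_k of the cubes over which
   the mean of g exceeds 2^k / A.  Vitali covering applied to g 1_{g > 2^k/2A}
   gives |F_k| <= C 2^-k int_{g > 2^k/2A} g, while Psi(x, M) <= C 2^k / k when
   2^k < M(x) <= 2^(k+1).  Summing, int Psi is bounded by
   int g sum_{2^k < 2A g} 1/k, and the inner sum is O(1 + log+ log+ g). *)

(** * Cubes in R^d *)

(** Under the hypothesis on f the maximal function need not be integrable near the ball: summing its
    level sets with weights 2^k would ask for g log g to be integrable. The denominator log(e+t) of
    [Psi] lowers the weight of the k-th layer to 2^k/k, so that a harmonic sum over k < log_2(2Ag)
    replaces a count of the levels; this is the origin of the double logarithm.

    The maximal function is a supremum over uncountably many scales. To avoid its measurability,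
    Psi(x, M) is dominated pointwise by weighted series of indicators of measurable sets, and only
    the measures of these sets enter the integral. The decay |x|^-(d+1) is integrated in the same
    way, over concentric dyadic cubes. Points with M = +oo are covered too: they lie in every F_k,
    and there the series diverges. *)

Lemma rV_ballP (R : realType) n (c : 'rV[R]_n) (r : R) (x : 'rV[R]_n) :
  0 < r -> (ball c r x <-> forall i, `|c ord0 i - x ord0 i| < r).
Proof.
move=> r0; split=> [[_ H] i|H]; first exact: H.
by split=> // i j; rewrite (ord1 i); exact: H.
Qed.

Lemma measurable_rV_ball (R : realType) n (c : 'rV[R]_n) (r : R) :
  measurable (ball c r : set 'rV[R]_n).
Proof.
have [r0|r0] := ltP 0 r; last first.
  by rewrite (_ : ball c r = set0)// -subset0 => x [/(le_lt_trans r0)]; rewrite ltxx.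
rewrite (_ : ball c r = \big[setI/setT]_(i < n)
    [set x : 'rV[R]_n | ball (c ord0 i) r (x ord0 i)]).
  apply: bigsetI_measurable => i _.
  rewrite (_ : [set _ | _] = [set: 'rV[R]_n] `&`
    (fun x : 'rV[R]_n => x ord0 i) @^-1` (ball (c ord0 i) r)).
    by apply: measurable_rV_coord => //; rewrite ball_itv; exact: measurable_itv.
  by rewrite setTI.
apply/seteqP; split=> x.
  by move=> /(rV_ballP _ _ r0) H; rewrite -bigcap_seq => i _ /=; exact: H.
rewrite -bigcap_seq => H; apply/rV_ballP => // i.
exact: (H i (mem_index_enum _)).
Qed.

(** Under [rV_snoc] a cube pulls back to a lower-dimensional cube times an interval of length 2r, so
    each dimension contributes one factor. In dimension 0 the Dirac mass supplies 1 = (2r)^0. *)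
Lemma borel_lebesgue_rV_ball (R : realType) n (c : 'rV[R]_n) (r : R) : 0 < r ->
  borel_lebesgue_rV R n (ball c r) = ((r *+ 2) ^+ n)%:E.
Proof.
move=> r0; elim: n c => [|n ih] c.
  rewrite /= diracE expr0 mem_set//; apply/rV_ballP => // -[] //.
rewrite /= /pushforward.
pose c1 : 'rV[R]_n := \row_i c ord0 (lift ord_max i).
rewrite (_ : _ @^-1` _ = ball c1 r `*` ball (c ord0 ord_max) r).
  rewrite product_measure1E; [|exact: measurable_rV_ball|by rewrite ball_itv; exact: measurable_itv].
  by rewrite [X in (X * _)%E](ih c1) [X in (_ * X)%E]lebesgue_measure_ball ?ltW// exprSr.
apply/seteqP; split=> -[p t] /=.
  move=> /(rV_ballP _ _ r0) H; split.
    apply/rV_ballP => // i; have := H (lift ord_max i).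
    by rewrite /rV_snoc !mxE liftK.
  by have := H ord_max; rewrite /rV_snoc !mxE unlift_none.
move=> [/= /(rV_ballP _ _ r0) H1 H2]; apply/rV_ballP => // i.
rewrite /rV_snoc !mxE; case: unliftP => [j ->|->] //=.
by have := H1 j; rewrite mxE.
Qed.

Lemma measurable_lebesgue_space (R : realType) n (A : set 'rV[R]_n) :
  measurable A -> measurable (A : set (lebesgue_space R n)).
Proof.
move=> mA; apply: (@sub_caratheodory _ _ _ (borel_lebesgue_rV R n)).
exact: sub_sigma_algebra.
Qed.

Lemma measurable_lebesgue_ball (R : realType) n (c : 'rV[R]_n) (r : R) :
  measurable (ball c r : set (lebesgue_space R n)).
Proof. by apply: measurable_lebesgue_space; exact: measurable_rV_ball. Qed.

Lemma lebesgue_rV_ball (R : realType) n (c : 'rV[R]_n) (r : R) : 0 < r ->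
  lebesgue_rV (ball c r : set (lebesgue_space R n)) = ((r *+ 2) ^+ n)%:E.
Proof.
move=> r0; rewrite -(borel_lebesgue_rV_ball c r0).
apply: (@measurable_mu_extE _ _ _ (borel_lebesgue_rV R n)).
exact: measurable_rV_ball.
Qed.

Section rational_cubes.
Variables (R : realType) (n : nat).

Definition rat_cube (i : rat * 'rV[rat]_n) : set 'rV[R]_n :=
  ball (map_mx ratr i.2 : 'rV[R]_n) (ratr i.1).

(** After moving the centre by less than e, any radius above 2e suffices, and it can be kept below
    3e. This upper bound is the origin of the factor 6 in [large_maximalP]. *)
Lemma rat_cube_sup (x : 'rV[R]_n) (e : R) : 0 < e ->
  exists i : rat * 'rV[rat]_n,
    [/\ 0 < (ratr i.1 : R), (ratr i.1 : R) < e *+ 3 & ball x e `<=` rat_cube i].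
Proof.
move=> e0.
have /rat_in_itvoo[q] : e *+ 2 < e *+ 3 by lra.
rewrite in_itv/= => /andP[q2 q3].
have /choice[m xm] : forall k, exists q : rat, `|x ord0 k - ratr q| < e.
  move=> k; have /rat_in_itvoo[p] : x ord0 k - e < x ord0 k + e by lra.
  by rewrite in_itv/= => p1; exists p; rewrite ltr_distlC.
have q0 : 0 < (ratr q : R) by lra.
exists (q, \row_k m k); split => //= y /(rV_ballP _ _ e0) xy.
apply/rV_ballP => // k; rewrite !mxE.
rewrite (le_lt_trans (ler_distD (x ord0 k) _ _))// (lt_trans _ q2)//.
by rewrite mulr2n ltrD// distrC.
Qed.

Lemma rat_cube_sub (U : set 'rV[R]_n) (x : 'rV[R]_n) : open U -> U x ->
  exists i : rat * 'rV[rat]_n, rat_cube i x /\ rat_cube i `<=` U.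
Proof.
move=> oU Ux; have /nbhs_ballP[e /= e0 eU] := open_nbhs_nbhs (conj oU Ux).
(* The radius is then below e / 2, and two points of the cube are less than two radii apart. *)
have e6 : 0 < e / 6 by lra.
have [i [i0 ie xi]] := rat_cube_sup x e6.
have ix : rat_cube i x by apply: xi; exact: ballxx.
exists i; split => // y iy; apply: eU.
apply: (@le_ball _ _ _ (ratr i.1 + ratr i.1)); first lra.
by apply: ball_triangle iy; exact: ball_sym.
Qed.

(** The sigma-algebra is generated by the coordinates and the topology by the sup norm; a countable
    base of measurable cubes connects the two. *)
Lemma open_rV_measurable (U : set 'rV[R]_n) : open U -> measurable U.
Proof.
move=> oU; rewrite (_ : U = \bigcup_i
    (if `[< rat_cube i `<=` U >] then rat_cube i else set0)).
  apply: countable_bigcupT_measurable => // i.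
  by case: ifP => _ //; exact: measurable_rV_ball.
apply/seteqP; split => [x Ux|x [i _]].
  have [i [ix iU]] := rat_cube_sub oU Ux.
  by exists i => //; case: asboolP.
by case: asboolP => // iU /iU.
Qed.

Lemma continuous_lebesgue_measurable (u : 'rV[R]_n -> R) : continuous u ->
  measurable_fun [set: lebesgue_space R n] u.
Proof.
move=> cu; apply: (measurability _ (RGenOpens.measurableE R)).
move=> _ [_ [a [b ->] <-]]; rewrite setTI; apply: measurable_lebesgue_space.
apply: open_rV_measurable; move/continuousP : cu; apply.
exact: interval_open.
Qed.

End rational_cubes.

(** * Covering and the weak type estimate *)

Lemma seq_max_exists (R : realType) (I : eqType) (r : I -> R) (s : seq I) :
  s != [::] -> exists2 i, i \in s & forall j, j \in s -> r j <= r i.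
Proof.
elim: s => // a [|b s] ih _.
  by exists a; rewrite ?mem_seq1// => j; rewrite mem_seq1 => /eqP ->.
have [//|i is_ ri] := ih.
have [ai|ia] := leP (r a) (r i).
  exists i; first by rewrite inE is_ orbT.
  by move=> j; rewrite inE => /predU1P[->//|]; exact: ri.
exists a; first by rewrite mem_head.
move=> j; rewrite inE => /predU1P[->//|/ri rj].
by rewrite (le_trans rj)// ltW.
Qed.

Section covering.
Variables (R : realType) (n : nat).
Local Notation V := 'rV[R]_n.
Local Notation mu := (@lebesgue_rV R n).
Local Open Scope ereal_scope.

Lemma ball_triple (x y : V) (r s : R) : (0 < r)%R -> (r <= s)%R ->
  ball x r `&` ball y s !=set0 -> ball x r `<=` ball y (s *+ 3).
Proof.
move=> r0 rs [z [xz yz]] w xw.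
apply: (@le_ball _ _ _ (s + (r + r))); first by lra.
apply: (ball_triangle yz); apply: ball_triangle xw; exact: ball_sym.
Qed.

(* Vitali: the largest cube, tripled, absorbs every cube meeting it, and the
   remaining cubes are disjoint from it. *)
Lemma finite_covering_measure (I : eqType) (c : I -> V) (r : I -> R)
    (g : lebesgue_space R n -> \bar R) (K : R) (s : seq I) :
  measurable_fun setT g -> (forall x, 0 <= g x) -> (0 <= K)%R ->
  (forall i, i \in s -> (0 < r i)%R) ->
  (forall i, i \in s -> mu (ball (c i) (r i)) <=
     K%:E * \int[mu]_(x in ball (c i) (r i)) g x) ->
  mu (\bigcup_(i in [set` s]) ball (c i) (r i)) <=
    (3 ^+ n * K)%:E * \int[mu]_(x in \bigcup_(i in [set` s]) ball (c i) (r i)) g x.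
Proof.
move=> mg g0 K0.
have mB i : measurable (ball (c i) (r i) : set (lebesgue_space R n)).
  exact: measurable_lebesgue_ball.
have mU (t : seq I) : measurable (\bigcup_(i in [set` t]) ball (c i) (r i) : set (lebesgue_space R n)).
  by apply: fin_bigcup_measurable => [|i _]; [exact: finite_seq|exact: mB].
have [m] := ubnP (size s); elim: m s => // m ih s sm rs Ks.
have [->|s0] := eqVneq s [::].
  by rewrite set_nil bigcup_set0 measure0 integral_set0 mule0.
have [i si maxi] := seq_max_exists r s0.
pose s' := [seq j <- s | `[< ball (c i) (r i) `&` ball (c j) (r j) = set0 >]].
have s's j : j \in s' -> j \in s by rewrite mem_filter => /andP[].
have s'dis j : j \in s' -> ball (c i) (r i) `&` ball (c j) (r j) = set0.
  by rewrite mem_filter => /andP[/asboolP].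
have ri0 := rs _ si.
have is' : i \notin s'.
  apply/negP => /s'dis; rewrite setIid => /seteqP[+ _] => /(_ (c i)).
  by apply; exact: ballxx.
have ss' : (size s' < size s)%N.
  rewrite size_filter -(count_predC (fun j => `[< ball (c i) (r i) `&` ball (c j) (r j) = set0 >]) s).
  rewrite -[ltnLHS]addn0 ltn_add2l -has_count; apply/hasP; exists i => //=.
  by move: is'; rewrite mem_filter si andbT.
have {}ih := ih s' (leq_trans ss' sm) (fun j js => rs _ (s's _ js))
  (fun j js => Ks _ (s's _ js)).
set U := \bigcup_(j in [set` s]) _; set U' := \bigcup_(j in [set` s']) _ in ih.
have U'U : U' `<=` U by move=> x [j /= /s's js xj]; exists j.
have iU : ball (c i) (r i) `<=` U by move=> x xi; exists i.
have dis : [disjoint ball (c i) (r i) & U'].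
  apply/disj_setPS => x [xi [j /= /s'dis + xj]].
  by move=> /seteqP[+ _]; apply; split; [exact: xi|exact: xj].
have UU' : U `<=` ball (c i) (r i *+ 3) `|` U'.
  move=> x [j /= js xj].
  have [d|d] := pselect (ball (c i) (r i) `&` ball (c j) (r j) = set0).
    by right; exists j => //=; rewrite mem_filter js andbT; apply/asboolP.
  left; apply: (ball_triple (rs _ js) (maxi _ js) _ xj).
  by rewrite setIC; apply/set0P/eqP.
have m3 : mu (ball (c i) (r i *+ 3)) = (3 ^+ n)%:E * mu (ball (c i) (r i)).
  rewrite !lebesgue_rV_ball ?mulrn_wgt0// -EFinM -exprMn; congr (_ ^+ _)%:E.
  by rewrite mulrnAC mulr_natl.
(* Tripling costs 3^n in measure, but the integral is charged to the untripled cube, which is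
   disjoint from [U'], so the two integrals add up without overlap. *)
apply: (@le_trans _ _ (mu (ball (c i) (r i *+ 3)) + mu U')).
  have mi3 := measurable_lebesgue_ball (c i) (r i *+ 3).
  apply: (le_trans _ (@measureU2 _ _ _ mu _ _ mi3 (mU s'))).
  by apply: le_measure; rewrite ?inE//; [exact: mU|exact: measurableU].
apply: (@le_trans _ _ ((3 ^+ n * K)%:E * \int[mu]_(x in ball (c i) (r i) `|` U') g x)).
  rewrite ge0_integral_setU//; last exact: measurable_funTS.
    rewrite ge0_muleDr ?integral_ge0//; apply: leeD; last exact: ih.
    rewrite m3 EFinM -muleA lee_wpmul2l ?lee_fin//; exact: Ks.
  exact: mU.
rewrite lee_wpmul2l ?lee_fin ?mulr_ge0//.
apply: ge0_subset_integral => //; first by apply: measurableU; [exact: mB|exact: mU].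
- exact: mU.
- exact: measurable_funTS.
- by rewrite subUset.
Qed.

(** Bounding by the integral over the whole space makes the finite estimate uniform, so it survives
    exhaustion by finite lists, the measure being continuous along increasing unions. *)
Lemma countable_covering_measure (I : countType) (P : pred I) (c : I -> V) (r : I -> R)
    (g : lebesgue_space R n -> \bar R) (K : R) :
  measurable_fun setT g -> (forall x, 0 <= g x) -> (0 <= K)%R ->
  (forall i, P i -> (0 < r i)%R) ->
  (forall i, P i -> mu (ball (c i) (r i)) <=
     K%:E * \int[mu]_(x in ball (c i) (r i)) g x) ->
  mu (\bigcup_(i in [set i | P i]) ball (c i) (r i)) <=
    (3 ^+ n * K)%:E * \int[mu]_x g x.
Proof.
move=> mg g0 K0 r0 PK.
pose s k := [seq i <- pmap unpickle (iota 0 k) | P i].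
pose F k : set (lebesgue_space R n) := \bigcup_(i in [set` s k]) ball (c i) (r i).
have sP k i : i \in s k -> P i by rewrite mem_filter => /andP[].
have mF k : measurable (F k).
  by apply: fin_bigcup_measurable => [|i _]; [exact: finite_seq|exact: measurable_lebesgue_ball].
have UF : \bigcup_(i in [set i | P i]) ball (c i) (r i) = \bigcup_k F k.
  apply/seteqP; split=> [x [i /= Pi xi]|x [k _ [i /= /sP Pi xi]]]; last by exists i.
  exists (pickle i).+1 => //; exists i => //; rewrite /mkset/s.
  rewrite mem_filter Pi andTb mem_pmap; apply/mapP; exists (pickle i).
    by rewrite mem_iota add0n/=.
  by rewrite pickleK.
have ndF : nondecreasing_seq F.
  move=> k l kl; apply/subsetPset => x [i /= ik xi]; exists i => //=.
  move: ik; rewrite /s !mem_filter => /andP[-> /=].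
  rewrite !mem_pmap => /mapP[p + ->] ; rewrite mem_iota add0n => /andP[_ pk].
  by apply: map_f; rewrite mem_iota add0n/= (leq_trans pk).
rewrite UF; have cF := nondecreasing_cvg_mu (mu := mu) mF (bigcup_measurable (fun k _ => mF k)) ndF.
rewrite -(cvg_lim _ cF)//; apply: lime_le; first by apply/cvg_ex; eexists; exact: cF.
apply: nearW => k /=.
apply: (le_trans (finite_covering_measure mg g0 K0 _ _)).
- by move=> i /sP; exact: r0.
- by move=> i /sP; exact: PK.
rewrite lee_wpmul2l ?lee_fin ?mulr_ge0//.
apply: ge0_subset_integral => //; exact: mF.
Qed.

End covering.

Section weak_type.
Variables (R : realType) (n : nat).
Local Notation V := 'rV[R]_n.
Local Notation mu := (@lebesgue_rV R n).
Variable g : V -> R.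
Hypothesis mg : measurable_fun [set: lebesgue_space R n] g.
Hypothesis g0 : forall x, 0 <= g x.

(* Cubes with rational centre and radius: a countable family, so that the union
   below is measurable, and every cube lies in a comparable one. *)
Definition large_average (l : R) (i : rat * 'rV[rat]_n) : bool :=
  (0 < (ratr i.1 : R)) &&
  (l%:E * mu (@rat_cube R n i) < \int[mu]_(x in @rat_cube R n i) (g x)%:E)%E.

Definition large_maximal (l : R) : set V :=
  \bigcup_(i in [set i | large_average l i]) @rat_cube R n i.

Definition upper_level (l : R) : set (lebesgue_space R n) := [set x | l < g x].

Lemma measurable_upper_level l : measurable (upper_level l).
Proof.
rewrite (_ : upper_level l = setT `&` g @^-1` `]l, +oo[%classic).
  by apply: mg => //; exact: measurable_itv.
by rewrite setTI; apply/seteqP; split=> x /=; rewrite in_itv/= andbT.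
Qed.

Lemma measurable_large_maximal l :
  measurable (large_maximal l : set (lebesgue_space R n)).
Proof.
rewrite /large_maximal bigcup_mkcond.
apply: countable_bigcupT_measurable => // i.
by case: ifP => _ //; exact: measurable_lebesgue_ball.
Qed.

(** The rational cube around [ball x e] has radius below 3e, hence volume at most (6e)^n; the
    hypothesis pays for this enlargement. *)
Lemma large_maximalP (l e : R) (x : V) : 0 <= l -> 0 < e ->
  ((l * (6 * e) ^+ n)%:E < \int[mu]_(y in ball x e) (g y)%:E)%E ->
  large_maximal l x.
Proof.
move=> l0 e0 lt; have [i [i0 ie xi]] := rat_cube_sup x e0.
exists i; last by apply: xi; exact: ballxx.
rewrite /= /large_average i0/=; apply: lt_le_trans (le_lt_trans _ lt) _.
  rewrite lebesgue_rV_ball// -EFinM lee_fin ler_wpM2l// lerXn2r ?nnegrE ?mulr_ge0 ?mulrn_wge0 ?ltW//; lra.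
apply: ge0_subset_integral.
- exact: measurable_lebesgue_ball.
- exact: measurable_lebesgue_ball.
- by apply/measurable_funTS; exact/measurable_EFinP.
- by move=> y _; rewrite lee_fin.
- exact: xi.
Qed.

(** On a cube where the mean exceeds l, the values of g up to l/2 account for at most half of l
    times the volume. The truncated function carries the other half, so the covering bound applies
    to it with constant 2/l. *)
Lemma weak_type (l : R) : 0 < l ->
  (mu (large_maximal l) <= (3 ^+ n * (2 / l))%:E *
    \int[mu]_x (g x * \1_(upper_level (l / 2)) x)%:E)%E.
Proof.
move=> l0; pose h x := (g x * \1_(upper_level (l / 2)) x)%:E.
have mh : measurable_fun [set: lebesgue_space R n] h.
  apply/measurable_EFinP; apply: measurable_funM; first exact: mg.
  exact/measurable_indic/measurable_upper_level.
have h0 x : (0 <= h x)%E by rewrite lee_fin mulr_ge0.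
apply: countable_covering_measure => //.
- by rewrite divr_ge0// ltW.
- by move=> i /andP[].
move=> i /andP[i0]; rewrite -/(rat_cube i) => lt.
have mQ : measurable (rat_cube i : set (lebesgue_space R n)).
  exact: measurable_lebesgue_ball.
have : (\int[mu]_(x in rat_cube i) (g x)%:E <=
    (l / 2)%:E * mu (rat_cube i) + \int[mu]_(x in rat_cube i) h x)%E.
  rewrite -integral_cst// -ge0_integralD//; last 2 first.
  - by move=> x _; rewrite lee_fin divr_ge0// ltW.
  - exact: measurable_funTS.
  apply: ge0_le_integral; first exact: mQ.
  - by move=> x _; rewrite lee_fin.
  - by apply/measurable_funTS; exact/measurable_EFinP.
  - by apply: emeasurable_funD => //; exact: measurable_funTS.
  move=> x _; rewrite /= -EFinD lee_fin indicE.
  have [xl|xl] := boolP (x \in upper_level (l / 2)).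
    by rewrite mulr1 lerDr divr_ge0// ltW.
  rewrite mulr0 addr0 leNgt; apply/negP => gx; move/negP: xl; apply.
  by rewrite inE.
move=> /(lt_le_trans lt); rewrite lebesgue_rV_ball// -!EFinM.
case: (\int[mu]_(x in _) h x)%E => [t| |]; last by rewrite addeNy ltNge leNye.
- rewrite -EFinD -EFinM lte_fin lee_fin => lt1.
  have lt2 : l / 2 * (ratr i.1 *+ 2) ^+ n < t by lra.
  rewrite (_ : _ ^+ n = 2 / l * (l / 2 * (ratr i.1 *+ 2) ^+ n)); last by field; lra.
  by rewrite ler_wpM2l ?divr_ge0// ltW.
- by rewrite gt0_muley ?leey// lte_fin divr_gt0.
Qed.

End weak_type.

(** * Summation over dyadic levels *)

Section iterated_logarithm.
Variable R : realType.

Lemma harmonic_le_ln (n : nat) :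
  \sum_(k < n.+1) (k.+1%:R : R)^-1 <= 1 + ln n.+1%:R.
Proof.
elim: n => [|n ih]; first by rewrite big_ord_recr big_ord0/= add0r ln1 addr0 invr1.
rewrite big_ord_recr/=; apply: le_trans (lerD ih (lexx _)) _.
rewrite -addrA lerD2l -lerBrDl.
have n1 : (0 : R) < n.+1%:R by rewrite ltr0n.
have n2 : (0 : R) < n.+2%:R by rewrite ltr0n.
(* In this form the increment is bounded below through ln(1 + x) <= x. *)
have -> : ln n.+2%:R - ln n.+1%:R = - ln (1 + - (n.+2%:R)^-1) :> R.
  rewrite -[LHS]opprB -ln_div ?posrE//; congr (- ln _).
  have -> : n.+2%:R = n.+1%:R + 1 :> R by rewrite natr1.
  move: (n.+1%:R) n1 => a a0; field.
  by rewrite gt_eqF// addr_gt0.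
rewrite lerNr le_ln1Dx// ltrN2 invf_lt1// ltr1n //.
Qed.

Lemma ln_2_gt0 : 0 < ln (2 : R).
Proof. by rewrite ln_gt0// ltr1n. Qed.

Lemma lnp_ge0 (t : R) : 0 <= lnp t.
Proof. by rewrite /lnp le_max lexx orbT. Qed.

(** Holds on the whole line because [ln] takes the value 0 at non-positive arguments. *)
Lemma le_lnp (s t : R) : s <= t -> lnp s <= lnp t.
Proof.
move=> st; have [s0|s0] := leP s 0.
  by rewrite {1}/lnp ln0// maxxx lnp_ge0.
by rewrite /lnp ge_max !le_max ler_ln ?posrE// ?st ?lexx ?orbT//; exact: lt_le_trans st.
Qed.

Lemma lnpM (a t : R) : 1 <= a -> 0 <= t -> lnp (a * t) <= ln a + lnp t.
Proof.
move=> a1; have a0 : 0 < a by exact: lt_le_trans a1.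
rewrite le_eqVlt => /predU1P[<-|t0].
  by rewrite mulr0 {1}/lnp ln0// maxxx addr_ge0 ?ln_ge0 ?lnp_ge0.
rewrite {1}/lnp lnM ?posrE// ge_max addr_ge0 ?ln_ge0 ?lnp_ge0// andbT.
by rewrite lerD2l /lnp le_max lexx.
Qed.

(** Since a + b <= (1 + a) max(b, 1), the sum reduces to a product. *)
Lemma lnpD (a b : R) : 0 <= a -> lnp (a + b) <= ln (1 + a) + lnp b.
Proof.
move=> a0; have a1 : 1 <= 1 + a by rewrite lerDl.
have [b1|b1] := leP b 1.
  apply: le_trans (@le_lnp _ ((1 + a) * 1) _) _; first by rewrite mulr1; lra.
  rewrite (le_trans (lnpM a1 ler01))// lerD2l.
  by rewrite {1}/lnp ln1 maxxx lnp_ge0.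
apply: le_trans (@le_lnp _ ((1 + a) * b) _) _; first by nra.
by apply: lnpM => //; lra.
Qed.

(** Only terms with k + 1 < log_2 s survive, and the harmonic sum up to there is at most 1 +
    ln(log_2 s) = 1 + ln ln s - ln ln 2. *)
Lemma dyadic_harmonic_le (s : R) (N : nat) :
  \sum_(k < N) (if 2 ^+ k.+1 < s then (k.+1%:R : R)^-1 else 0) <=
  1 + `|ln (ln 2)| + lnp (lnp s).
Proof.
elim: N => [|N ih].
  by rewrite big_ord0 !addr_ge0 ?lnp_ge0.
(* If the last term vanishes, the sum is the previous one. If it does not, the sum is compared with
   a full harmonic sum, whose length is controlled by s. *)
have [lt|ge] := ltP (2 ^+ N.+1) s; last first.
  by rewrite big_ord_recr/= ltNge ge addr0.
apply: (@le_trans _ _ (\sum_(k < N.+1) (k.+1%:R : R)^-1)).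
  by apply: ler_sum => k _; case: ifP.
apply: (le_trans (harmonic_le_ln N)); rewrite -addrA lerD2l.
have N0 : (0 : R) < N.+1%:R by rewrite ltr0n.
have l2 := ln_2_gt0.
have s0 : 0 < s by exact: le_lt_trans lt.
have lns : N.+1%:R * ln 2 < ln s.
  by rewrite mulr_natl -lnXn ?ltr0n// ltr_ln ?posrE ?exprn_gt0.
have lns0 : 0 < ln s by apply: lt_trans lns; rewrite mulr_gt0.
have : ln (N.+1%:R * ln 2) <= ln (ln s).
  by rewrite ler_ln ?posrE ?mulr_gt0// ltW.
rewrite lnM ?posrE// => le1.
have le2 : ln (ln s) <= lnp (lnp s).
  have -> : lnp s = ln s by rewrite /lnp; apply/max_idPl; exact: ltW.
  by rewrite /lnp le_max lexx.
have := ler_norm (- ln (ln (2 : R))); rewrite normrN; lra.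
Qed.

(** Serves to absorb the factor 2A, which stands between g and the dyadic levels, into an additive
    constant. *)
Lemma lnp_lnpM (a : R) : 1 <= a -> exists c, 0 <= c /\
  forall t, 0 <= t -> lnp (lnp (a * t)) <= c + lnp (lnp t).
Proof.
move=> a1; exists (ln (1 + ln a)); split.
  by rewrite ln_ge0// lerDl ln_ge0.
move=> t t0; apply: le_trans (le_lnp (lnpM a1 t0)) _.
by apply: lnpD; exact: ln_ge0.
Qed.

End iterated_logarithm.

Section level_sums.
Variables (R : realType) (n : nat).
Local Notation V := 'rV[R]_n.
Local Notation mu := (@lebesgue_rV R n).
Variable g : V -> R.
Hypothesis mg : measurable_fun [set: lebesgue_space R n] g.
Hypothesis g0 : forall x, 0 <= g x.
Hypothesis gL1 : (\int[mu]_x (g x)%:E < +oo)%E.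
Hypothesis gLL : (\int[mu]_x (g x * lnp (lnp (g x)))%:E < +oo)%E.

Lemma measurable_lnp (u : V -> R) : measurable_fun [set: lebesgue_space R n] u ->
  measurable_fun [set: lebesgue_space R n] (fun x => lnp (u x)).
Proof.
move=> mu_; apply: measurable_maxr; last exact: measurable_cst.
by apply: measurableT_comp mu_; exact: measurable_ln.
Qed.

Lemma sum_large_maximal_lty (A : R) : 1 <= A ->
  (\sum_(k <oo) ((2 ^+ k.+1 / k.+1%:R)%:E *
      mu (large_maximal g (2 ^+ k.+1 / A))) < +oo)%E.
Proof.
move=> A1; have A0 : 0 < A by exact: lt_le_trans A1.
have [c [c0 cP]] : exists c, 0 <= c /\
    forall t, 0 <= t -> lnp (lnp (2 * A * t)) <= c + lnp (lnp t).
  by apply: lnp_lnpM; lra.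
pose C := 3 ^+ n * (2 * A).
pose u k (x : lebesgue_space R n) := (g x * \1_(upper_level g (2 ^+ k.+1 / A / 2)) x)%:E.
pose h (k : nat) (x : lebesgue_space R n) := ((k.+1%:R^-1)%:E * u k x)%E.
have mgE : measurable_fun [set: lebesgue_space R n] (EFin \o g).
  exact/measurable_EFinP.
have mu_ k : measurable_fun [set: lebesgue_space R n] (u k).
  apply/measurable_EFinP; apply: measurable_funM; first exact: mg.
  by apply/measurable_indic; exact: measurable_upper_level.
have u0 k x : (0 <= u k x)%E by rewrite lee_fin mulr_ge0.
have mh k : measurable_fun [set: lebesgue_space R n] (h k).
  by apply: measurable_funeM; exact: mu_.
have h0 k x : (0 <= h k x)%E by rewrite mule_ge0// lee_fin.
(* The weight 2^(k+1) cancels against the 1/l of [weak_type]; what remains is 1/(k+1) and the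
   constant [C]. *)
have term k : ((2 ^+ k.+1 / k.+1%:R)%:E * mu (large_maximal g (2 ^+ k.+1 / A)) <=
    C%:E * \int[mu]_x h k x)%E.
  have p2 : (0 : R) < 2 ^+ k.+1 by rewrite exprn_gt0.
  have l0 : 0 < 2 ^+ k.+1 / A by rewrite divr_gt0.
  have k0 : (0 : R) < k.+1%:R by rewrite ltr0n.
  rewrite ge0_integralZl_EFin//.
  apply: le_trans (lee_wpmul2l _ (weak_type mg g0 l0)) _.
    by rewrite lee_fin divr_ge0// ltW.
  rewrite muleA -EFinM muleA -EFinM le_eqVlt; apply/orP; left; apply/eqP.
  congr (_%:E * _)%E; rewrite /C; field.
  by rewrite !gt_eqF.
apply: (@le_lt_trans _ _ (\sum_(k <oo) (C%:E * \int[mu]_x h k x))%E).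
  apply: lee_nneseries => k _; last exact: term.
  by move=> _; rewrite mule_ge0// lee_fin divr_ge0.
have C0 : 0 <= C by rewrite mulr_ge0// mulr_ge0// ltW.
rewrite nneseriesZl//; last by move=> k _; apply: integral_ge0.
rewrite -integral_nneseries; [|exact: measurableT|exact: mh|by []].
(* Pointwise bound for the sum over k; its two summands have finite integral by [gL1] and [gLL]. *)
pose w (x : lebesgue_space R n) := ((1 + `|ln (ln (2 : R))| + c)%:E * (g x)%:E + (g x * lnp (lnp (g x)))%:E)%E.
apply: (@le_lt_trans _ _ (C%:E * \int[mu]_x w x)%E).
  rewrite lee_wpmul2l ?lee_fin//; apply: ge0_le_integral.
  - exact: measurableT.
  - by move=> x _; exact: nneseries_ge0.
  - by apply: ge0_emeasurable_sum => // k _; exact: mh.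
  - apply: emeasurable_funD; first by apply: measurable_funeM; exact: mgE.
    apply/measurable_EFinP; apply: measurable_funM; first exact: mg.
    by apply: measurable_lnp; apply: measurable_lnp; exact: mg.
  move=> x _; apply: lime_le; first by apply: is_cvg_nneseries => k _ _; exact: h0.
  apply: nearW => N; rewrite big_mkord.
  under eq_bigr do rewrite /h /u -EFinM.
  rewrite sumEFin /w -EFinM -EFinD lee_fin.
  apply: (@le_trans _ _ (g x * \sum_(k < N)
      (if 2 ^+ k.+1 < 2 * A * g x then (k.+1%:R : R)^-1 else 0))).
    rewrite mulr_sumr ler_sum// => k _; rewrite indicE.
    have [xk|xk] := boolP (x \in _); last by rewrite !mulr0 mulr_ge0//; case: ifP.
    move: xk; rewrite inE /upper_level/= !ltr_pdivrMr// => xk.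
    have -> : 2 ^+ k.+1 < 2 * A * g x by lra.
    by rewrite mulr1 mulrC.
  rewrite [leRHS](_ : _ = g x * (1 + `|ln (ln 2)| + c + lnp (lnp (g x)))); last by ring.
  rewrite ler_wpM2l//.
  apply: (le_trans (dyadic_harmonic_le _ _)).
  have := cP _ (g0 x); lra.
rewrite ge0_integralD; last 5 first.
- exact: measurableT.
- by move=> x _; rewrite -EFinM lee_fin mulr_ge0// !addr_ge0.
- by apply: measurable_funeM; exact: mgE.
- by move=> x _; rewrite lee_fin mulr_ge0// lnp_ge0.
- apply/measurable_EFinP; apply: measurable_funM; first exact: mg.
  by apply: measurable_lnp; apply: measurable_lnp; exact: mg.
rewrite ge0_integralZl_EFin//; last 2 first.
- by move=> x _; rewrite lee_fin.
- by rewrite !addr_ge0.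
by rewrite lte_mul_pinfty// ?lee_fin// lte_add_pinfty// lte_mul_pinfty// ?lee_fin ?addr_ge0.
Qed.

End level_sums.

(** * Lipschitz test functions *)

Section sup_norm.
Variables (R : realType) (n : nat).
Local Notation V := 'rV[R]_n.

Lemma coord_le_norm (x : V) i : `|x ord0 i| <= `|x|.
Proof.
have /mapP[j Hj ->] : `|x ord0 i| \in [seq `|x k.1 k.2| | k : 'I_1 * 'I_n].
  by apply/mapP; exists (ord0, i) => //=; rewrite mem_enum.
by rewrite [leRHS]/Num.norm /= mx_normrE; apply/bigmax_geP; right => /=; exists j.
Qed.

Lemma norm_le_coord (x : V) (r : R) : 0 <= r ->
  (forall i, `|x ord0 i| <= r) -> `|x| <= r.
Proof.
move=> r0 H; rewrite /Num.norm/= mx_normrE; apply/bigmax_leP; split => //= -[a b] _.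
by rewrite (ord1 a); exact: H.
Qed.

(** Through this comparison the Euclidean support conditions on f and phi are used with cubes. *)
Lemma norm_le_enorm (x : V) : `|x| <= enorm x.
Proof.
apply: norm_le_coord; first exact: sqrtr_ge0.
move=> i; rewrite -sqrtr_sqr ler_wsqrtr// (bigD1 i)//= lerDl.
by apply: sumr_ge0 => j _; exact: sqr_ge0.
Qed.

Lemma unit_ball_norm (x : V) : unit_ball x -> `|x| <= 1.
Proof. exact/le_trans/norm_le_enorm. Qed.

Lemma compact_norm_le (r : R) : compact [set x : V | `|x| <= r].
Proof.
apply: bounded_closed_compact.
  exists r; split; first exact: num_real.
  by move=> M rM x /= xr; rewrite (le_trans xr)// ltW.
rewrite (_ : [set x | _] = (fun x : V => `|x|) @^-1` [set t : R | t <= r]); last by [].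
apply: closed_comp; last exact: closed_le.
by move=> x _; exact: norm_continuous.
Qed.

Lemma bounded_of_compact_support (u : V -> R) : continuous u ->
  (forall x, 1 < `|x| -> u x = 0) -> exists2 K, 0 <= K & forall x, `|u x| <= K.
Proof.
move=> cu u0.
have /compact_bounded[M [_ HM]] : compact (u @` [set x : V | `|x| <= 1]).
  apply: continuous_compact; last exact: compact_norm_le.
  exact: continuous_subspaceT.
have M1 : M < `|M| + 1 by rewrite (le_lt_trans (ler_norm M))// ltrDl.
exists (`|M| + 1); first by rewrite addr_ge0.
move=> x; have [x1|x1] := leP `|x| 1; last by rewrite u0// normr0 addr_ge0.
by apply: (HM _ M1); exists x.
Qed.

Lemma line_mean_value (u : V -> R) (v x : V) (K t : R) : 0 <= t ->
  (forall y, derivable u y v) -> (forall y, `|'D_v u y| <= K) ->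
  `|u (x + t *: v) - u x| <= K * t.
Proof.
move=> t0 du duK; pose h (s : R) := u (s *: v + x).
(* The difference quotient of h in direction 1 is that of u in direction v, which brings the
   one-dimensional mean value theorem into play. *)
have hE (s : R) : (fun k : R => k^-1 *: ((h \o shift s) (k *: 1) - h s)) =
    (fun k : R => k^-1 *: ((u \o shift (s *: v + x)) (k *: v) - u (s *: v + x))).
  by apply/funext => k; rewrite /h /= [k *: 1]mulr1 scalerDl addrA.
have dh (s : R) : is_derive s (1 : R) h ('D_v u (s *: v + x)).
  split; first by rewrite /derivable hE; exact: du.
  by rewrite /derive hE.
have [|c _] := @MVT_segment R h (fun s => 'D_v u (s *: v + x)) 0 t t0 (fun s _ => dh s).
  by apply: derivable_within_continuous => s _; exact: ex_derive.
rewrite /h scale0r add0r subr0 (addrC _ x) => ->.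
by rewrite normrM (ger0_norm t0) ler_wpM2r.
Qed.

(** Only partial derivatives are at hand, so x is reached from y by changing one coordinate at a
    time; each of the n steps costs at most K times the sup norm of x - y. *)
Lemma coordinatewise_lipschitz (u : V -> R) (K : R) :
  (forall (i : 'I_n) y, derivable u y (delta_mx 0 i : V)) ->
  (forall (i : 'I_n) y, `|'D_(delta_mx 0 i : V) u y| <= K) ->
  forall x y : V, `|u x - u y| <= n%:R * K * `|x - y|.
Proof.
move=> du duK x y.
pose w (k : nat) : V := \row_i (if (i < k)%N then x ord0 i else y ord0 i).
have step (k : nat) : (k < n)%N -> `|u (w k.+1) - u (w k)| <= K * `|x - y|.
  move=> kn; pose i := Ordinal kn; pose t := x ord0 i - y ord0 i.
  have tn : `|t| <= `|x - y| by have := coord_le_norm (x - y) i; rewrite !mxE.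
  have K0 : 0 <= K by apply: le_trans (duK i 0).
  have wS : w k.+1 = w k + t *: delta_mx 0 i.
    apply/rowP => j; rewrite !mxE /= ltnS leq_eqVlt; case: (eqVneq j i) => [->|ji].
      by rewrite /= eqxx ltnn mulr1 /t subrKC.
    rewrite mulr0 addr0 (_ : (j == k :> nat) = false)//.
    by apply/negbTE/eqP => jk; move/eqP : ji; apply; apply/val_inj.
  (* For negative t the endpoints are exchanged, as [line_mean_value] asks for a non-negative
     step. *)
  have [t0|/ltW t0] := leP 0 t.
    rewrite wS; apply: le_trans (line_mean_value _ t0 (du i) (duK i)) _.
    by rewrite ler_wpM2l// -(ger0_norm t0).
  rewrite distrC (_ : w k = w k.+1 + (- t) *: delta_mx 0 i); last first.
    by rewrite wS scaleNr addrK.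
  have nt0 : 0 <= - t by rewrite oppr_ge0.
  apply: le_trans (line_mean_value _ nt0 (du i) (duK i)) _.
  by rewrite ler_wpM2l// -(ler0_norm t0).
have main (k : nat) : (k <= n)%N -> `|u (w k) - u (w 0)| <= k%:R * (K * `|x - y|).
  elim: k => [_|k ih kn]; first by rewrite subrr normr0 mul0r.
  rewrite -[k.+1%:R]natr1 mulrDl mul1r [leRHS]addrC.
  rewrite (le_trans (ler_distD (u (w k)) _ _))//.
  by rewrite lerD// ?step// ih// ltnW.
have := main n (leqnn n); rewrite mulrA.
congr (`|u _ - u _| <= _); apply/rowP => j; rewrite !mxE ?ltn_ord//.
Qed.

Lemma smooth_lipschitz (u : V -> R) : smooth u ->
  (forall x, 1 < `|x| -> u x = 0) ->
  exists2 L, 0 <= L & forall x y : V, `|u x - u y| <= L * `|x - y|.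
Proof.
move=> su u0.
have /choice[K KP] : forall i : 'I_n, exists K, 0 <= K /\
    forall y, `|'D_(delta_mx 0 i : V) u y| <= K.
  move=> i; have [ci _] := su [:: i].
  have [|K K0 KP] := bounded_of_compact_support ci.
    move=> x x1; rewrite /= (_ : 'D_(delta_mx 0 i : V) u x = 'D_(delta_mx 0 i : V) (cst 0) x).
      by rewrite derive_cst.
    (* u vanishes on a whole neighbourhood of such an x, hence so does its partial derivative at
       x. *)
    apply: near_eq_derive.
    have /nbhs_ballP : nbhs x [set z : V | 1 < `|z|].
      exact: (@cvgr_gt _ _ _ _ _ _ (@norm_continuous _ V x) _ x1).
    by move=> [e /= e0 eP]; apply/nbhs_ballP; exists e => //= z /eP /=; exact: u0.
  by exists K.
exists (n%:R * \sum_i K i).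
  by rewrite mulr_ge0// sumr_ge0// => i _; have [] := KP i.
apply: coordinatewise_lipschitz.
  by move=> i y; have [_] := su [::]; exact.
move=> i y; rewrite (bigD1 i)//= (le_trans ((KP i).2 y))// lerDl.
by apply: sumr_ge0 => j _; have [] := KP j.
Qed.

End sup_norm.

(** * Complex-valued integrals *)

Section complex_modulus.
Variable R : realType.
Local Notation C := R[i].
Local Notation normc := (@Normc.normc R).

Lemma normcE (z : C) : normc z = Num.sqrt (complex.Re z ^+ 2 + complex.Im z ^+ 2).
Proof. by case: z. Qed.

Lemma normc_ge0 (z : C) : 0 <= normc z.
Proof. by rewrite normcE sqrtr_ge0. Qed.

Lemma Re_le_normc (z : C) : `|complex.Re z| <= normc z.
Proof. by rewrite normcE -sqrtr_sqr ler_wsqrtr// lerDl sqr_ge0. Qed.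

Lemma Im_le_normc (z : C) : `|complex.Im z| <= normc z.
Proof. by rewrite normcE -sqrtr_sqr ler_wsqrtr// lerDr sqr_ge0. Qed.

Lemma normc_le_ReIm (z : C) : normc z <= `|complex.Re z| + `|complex.Im z|.
Proof.
rewrite normcE -(ger0_norm (addr_ge0 (normr_ge0 (complex.Re z)) (normr_ge0 (complex.Im z)))).
rewrite -sqrtr_sqr ler_wsqrtr// sqrrD !real_normK ?num_real//.
by rewrite -addrA lerD2l lerDr mulrn_wge0// mulr_ge0.
Qed.

Lemma normc_real (a : R) : normc (Complex a 0) = `|a|.
Proof. by rewrite normcE /= expr0n addr0 sqrtr_sqr. Qed.

End complex_modulus.

Section complex_lebesgue_integral.
Variables (R : realType) (d : nat).
Local Notation Rd := 'rV[R]_d.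
Local Notation Ld := (lebesgue_space R d).
Local Notation C := R[i].
Local Notation mu := (@lebesgue_rV R d).
Local Notation normc := (@Normc.normc R).

Lemma measurable_unit_ball : measurable (@unit_ball R d : set Ld).
Proof.
rewrite (_ : @unit_ball R d = setT `&` (@enorm R d : Ld -> R) @^-1` `]-oo, 1]%classic).
  suff : measurable_fun [set: Ld] (@enorm R d) by apply => //; exact: measurable_itv.
  apply: (@measurableT_comp _ _ _ _ _ _ (@Num.sqrt R) _
    (fun x : Ld => \sum_i (x : Rd) ord0 i ^+ 2)).
    by apply: continuous_measurable_fun; exact: sqrt_continuous.
  apply: measurable_sum => i; apply: measurable_funX.
  move=> _ Y mY; rewrite setTI; apply: measurable_lebesgue_space.
  by have := @measurable_rV_coord R d i measurableT Y mY; rewrite setTI.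
by rewrite setTI; apply/seteqP; split=> x /=; rewrite in_itv.
Qed.

Lemma measurable_normc (F : Rd -> C) : cmeasurable F ->
  measurable_fun [set: Ld] (fun x => normc (F x)).
Proof.
move=> [mRe mIm]; under eq_fun do rewrite normcE.
apply: (@measurableT_comp _ _ _ _ _ _ (@Num.sqrt R)).
  by apply: continuous_measurable_fun; exact: sqrt_continuous.
by apply: measurable_funD; apply: measurable_funX.
Qed.

Definition cintegrable (F : Rd -> C) : Prop :=
  mu.-integrable setT (fun x : Ld => (complex.Re (F x))%:E) /\
  mu.-integrable setT (fun x : Ld => (complex.Im (F x))%:E).

Lemma cintegrable_of_normc (F : Rd -> C) : cmeasurable F ->
  (\int[mu]_x (normc (F x))%:E < +oo)%E -> cintegrable F.
Proof.
move=> mF FL; have iF : mu.-integrable setT (fun x : Ld => (normc (F x))%:E).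
  apply/integrableP; split; first by apply/measurable_EFinP; exact: measurable_normc.
  rewrite (eq_integral (fun x : Ld => (normc (F x))%:E))// => x _.
  by rewrite gee0_abs// lee_fin normc_ge0.
split.
  apply: (le_integrable _ _ _ iF); first exact: measurableT.
    by apply/measurable_EFinP; exact: mF.1.
  by move=> x _; rewrite /= lee_fin (ger0_norm (normc_ge0 _)) Re_le_normc.
apply: (le_integrable _ _ _ iF); first exact: measurableT.
  by apply/measurable_EFinP; exact: mF.2.
by move=> x _; rewrite /= lee_fin (ger0_norm (normc_ge0 _)) Im_le_normc.
Qed.

Lemma cintegralZD (c : C) (F G : Rd -> C) : cintegrable F -> cintegrable G ->
  cintegral setT (fun x => c * F x + G x) = c * cintegral setT F + cintegral setT G.
Proof.
case: c => a b [iFr iFi] [iGr iGi].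
have iZ (k : R) (h : Ld -> R) : mu.-integrable setT (EFin \o h) ->
    mu.-integrable setT (EFin \o (fun x => k * h x)).
  by move=> ih; apply: (integrableZl _ k ih).
rewrite /cintegral /= /GRing.mul/= /GRing.add/=; congr Complex.
  rewrite (@eq_Rintegral _ _ _ _ _ (fun x : Ld => (a * complex.Re (F x) - b * complex.Im (F x)) + complex.Re (G x))); last first.
    by move=> x _; case: (F x) => ? ?; case: (G x).
  rewrite RintegralD//; last by apply: (integrableB _ (iZ _ _ iFr) (iZ _ _ iFi)).
  by rewrite RintegralB ?RintegralZl//; apply: iZ.
rewrite (@eq_Rintegral _ _ _ _ _ (fun x : Ld => (a * complex.Im (F x) + b * complex.Re (F x)) + complex.Im (G x))); last first.
  by move=> x _; case: (F x) => ? ?; case: (G x).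
rewrite RintegralD//; last by apply: (integrableD _ (iZ _ _ iFi) (iZ _ _ iFr)).
by rewrite RintegralD ?RintegralZl//; apply: iZ.
Qed.

Lemma normr_Rintegral_le (h k : Ld -> R) :
  mu.-integrable setT (fun x => (h x)%:E) -> measurable_fun setT k ->
  (forall x, `|h x| <= k x) ->
  (`|\int[mu]_x h x|%:E <= \int[mu]_x (k x)%:E)%E.
Proof.
move=> ih mk hk; have mh := measurable_int _ ih.
rewrite EFin_normr_Rintegral; [|exact: measurableT|exact: ih].
apply: le_trans (le_abse_integral mu measurableT mh) _.
apply: ge0_le_integral; first exact: measurableT.
- by [].
- exact: (measurableT_comp (@abse_measurable R setT) mh).
- by apply/measurable_EFinP; exact: mk.
- by move=> x _; rewrite lee_fin.
Qed.

(** The factor 2 comes from estimating the real and imaginary parts separately, each by the integral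
    of the modulus. *)
Lemma normc_cintegral_le (F : Rd -> C) : cmeasurable F ->
  ((normc (cintegral setT F))%:E <= 2%:E * \int[mu]_x (normc (F x))%:E)%E.
Proof.
move=> mF; have nF0 : (0 <= \int[mu]_x (normc (F x))%:E)%E.
  by apply: integral_ge0 => x _; rewrite lee_fin normc_ge0.
have [->|FL] := eqVneq (\int[mu]_x (normc (F x))%:E)%E +oo%E.
  by rewrite gt0_muley ?leey// lte_fin.
have iF := cintegrable_of_normc mF _; rewrite ltey in iF; have {iF}[iR iI] := iF FL.
have mnF : measurable_fun [set: Ld] (fun x => normc (F x)) by exact: measurable_normc.
apply: (@le_trans _ _ (`|complex.Re (cintegral setT F)|%:E + `|complex.Im (cintegral setT F)|%:E)%E).
  by rewrite -EFinD lee_fin normc_le_ReIm.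
rewrite (_ : 2 = 1 + 1)%R// EFinD ge0_muleDl ?lee_fin// mul1e.
apply: leeD.
  by apply: (normr_Rintegral_le iR mnF) => x; exact: Re_le_normc.
by apply: (normr_Rintegral_le iI mnF) => x; exact: Im_le_normc.
Qed.

Lemma negligible_bigcup_countType (I : countType) (P : set I) (F : I -> set Ld) :
  (forall i, P i -> mu.-negligible (F i)) ->
  mu.-negligible (\bigcup_(i in P) F i).
Proof.
move=> nF; pose G (k : nat) : set Ld := \bigcup_(i in [set i | P i /\ pickle i = k]) F i.
apply: (@negligibleS _ _ _ mu (\bigcup_k G k)).
  by move=> x [i Pi Fix]; exists (pickle i) => //; exists i.
apply: negligible_bigcup => k.
have [[i [Pi ik]]|h] := pselect (exists i, P i /\ pickle i = k).
  apply: negligibleS (nF i Pi) => x [j [_ jk] Fjx].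
  by rewrite (_ : i = j)//; apply: (pcan_inj pickleK); rewrite ik.
rewrite (_ : G k = set0); first exact: negligible_set0.
by apply/seteqP; split=> // x [i [Pi ik] _]; case: h; exists i.
Qed.

(** A Lindelof argument: every point outside the essential support lies in a rational cube on which
    F vanishes almost everywhere, and there are only countably many such cubes. *)
Lemma negligible_outside_ess_supp (F : Rd -> C) :
  mu.-negligible (~` ess_supp F `&` [set y | F y != 0]).
Proof.
pose N i : set Ld := @rat_cube R d i `&` [set y | F y != 0].
apply: (@negligibleS _ _ _ mu (\bigcup_(i in [set i | mu.-negligible (N i)]) N i)).
  move=> x [/existsNP[U /not_implyP[oU /not_implyP[Ux /contrapT nU]]] Fx].
  have [i [ix iU]] := rat_cube_sub oU Ux.
  exists i; last by split.
  by apply: negligibleS nU; exact: setSI.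
by apply: negligible_bigcup_countType.
Qed.

End complex_lebesgue_integral.

(** * The distribution defined by f: pairing bounds and temperedness *)

Section LloglogL_distribution.
Variables (R : realType) (d : nat).
Local Notation Rd := 'rV[R]_d.
Local Notation Ld := (lebesgue_space R d).
Local Notation C := R[i].
Local Notation mu := (@lebesgue_rV R d).
Local Notation normc := (@Normc.normc R).
Local Notation B := (@unit_ball R d).
Variable f : Rd -> C.
Hypothesis fB : LloglogL B f.

Let mf : cmeasurable f.
Proof. by case: fB => -[]. Qed.

Let mg : measurable_fun [set: Ld] (fun x => normc (f x)).
Proof. exact: measurable_normc. Qed.

(** f vanishes almost everywhere off the ball and h vanishes with it, so restricting h to the ball
    alters it on a null set only. *)
Lemma integral_unit_ball (h : Ld -> R) : measurable_fun setT h ->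
  (forall x, f x = 0 -> h x = 0) ->
  (\int[mu]_x (h x)%:E = \int[mu]_(x in B) (h x)%:E)%E.
Proof.
move=> mh h0; have mhE : measurable_fun [set: Ld] (EFin \o h) by exact/measurable_EFinP.
rewrite [RHS]integral_mkcond; apply: ae_eq_integral.
- exact: measurableT.
- exact: mhE.
- apply: (measurable_restrictT _ _).1; first exact: measurable_unit_ball.
  by apply: measurable_funTS.
apply: negligibleS (negligible_outside_ess_supp f) => x /= H.
apply: contrapT => nH; apply: H => _; rewrite patchE.
have [//|xB] := boolP (x \in (B : set Ld)).
congr EFin; apply: h0; apply: contrapT => fx; apply: nH; split; last exact/eqP.
move=> xS; move/negP: xB; apply; rewrite inE.
by case: fB => _ + _; exact.
Qed.

Lemma LloglogL_L1 : (\int[mu]_x (normc (f x))%:E < +oo)%E.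
Proof.
rewrite (@integral_unit_ball (fun x => normc (f x))); [|exact: mg|]; last first.
  by move=> x ->; rewrite Normc.normc0.
(* Local integrability is used on the unit cube of the sup norm, a compact set containing the
   ball. *)
have [[_ fK] _ _] := fB; apply: le_lt_trans (fK _ (compact_norm_le (r := 1))).
pose K : set Ld := [set x : Rd | `|x| <= 1].
have mK : measurable K.
  apply: measurable_lebesgue_space; rewrite -[K]setCK; apply: measurableC.
  apply: open_rV_measurable; apply: closed_openC; apply: compact_closed.
    exact: norm_hausdorff.
  exact: compact_norm_le.
apply: ge0_subset_integral.
- exact: measurable_unit_ball.
- exact: mK.
- by apply: measurable_funTS; apply/measurable_EFinP; exact: mg.
- by move=> x _; rewrite lee_fin normc_ge0.
- by move=> x; exact: unit_ball_norm.
Qed.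

Lemma LloglogL_loglog :
  (\int[mu]_x (normc (f x) * lnp (lnp (normc (f x))))%:E < +oo)%E.
Proof.
rewrite (@integral_unit_ball (fun x => normc (f x) * lnp (lnp (normc (f x))))).
- by case: fB.
- apply: measurable_funM; first exact: mg.
  by apply: measurable_lnp; apply: measurable_lnp; exact: mg.
- by move=> x ->; rewrite Normc.normc0 mul0r.
Qed.

Lemma cintegral_unit_ball : cintegral setT f = cintegral B f.
Proof.
rewrite /cintegral /Rintegral; congr (Complex (fine _) (fine _)).
  apply: (@integral_unit_ball (fun x => complex.Re (f x))); first exact: mf.1.
  by move=> x ->.
apply: (@integral_unit_ball (fun x => complex.Im (f x))); first exact: mf.2.
by move=> x ->.
Qed.

(** Contains the Schwartz functions, the kernels phi_eps(x - y) in y, and the constants, so that a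
    constant can be subtracted from a kernel by linearity. *)
Definition cbounded (u : Rd -> C) : Prop :=
  cmeasurable u /\ exists K, forall x, normc (u x) <= K.

Lemma cmeasurableM (u v : Rd -> C) : cmeasurable u -> cmeasurable v ->
  cmeasurable (fun x => u x * v x).
Proof.
move=> [mu1 mu2] [mv1 mv2]; split.
  rewrite (_ : (fun x => _) = (fun x : Ld => complex.Re (u x) * complex.Re (v x)
      - complex.Im (u x) * complex.Im (v x))).
    by apply: measurable_funB; apply: measurable_funM.
  by apply/funext => x; case: (u x) => ? ?; case: (v x).
rewrite (_ : (fun x => _) = (fun x : Ld => complex.Re (u x) * complex.Im (v x)
    + complex.Im (u x) * complex.Re (v x))).
  by apply: measurable_funD; apply: measurable_funM.
by apply/funext => x; case: (u x) => ? ?; case: (v x).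
Qed.

Lemma cintegrableMb (u : Rd -> C) : cbounded u -> cintegrable (fun x => f x * u x).
Proof.
move=> [mu_ [K uK]]; apply: cintegrable_of_normc; first exact: cmeasurableM.
have K0 : 0 <= K by apply: le_trans (uK 0); exact: normc_ge0.
apply: (@le_lt_trans _ _ (K%:E * \int[mu]_x (normc (f x))%:E)%E); last first.
  by rewrite lte_mul_pinfty ?lee_fin// LloglogL_L1.
rewrite -ge0_integralZl_EFin; last 4 first.
- exact: measurableT.
- by move=> x _; rewrite lee_fin normc_ge0.
- by apply/measurable_EFinP; exact: mg.
- exact: K0.
apply: ge0_le_integral; first exact: measurableT.
- by move=> x _; rewrite lee_fin normc_ge0.
- by apply/measurable_EFinP; apply: measurable_normc; exact: cmeasurableM.
- by apply: measurable_funeM; apply/measurable_EFinP; exact: mg.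
- move=> x _; rewrite -EFinM lee_fin Normc.normcM mulrC.
  by rewrite ler_wpM2r ?normc_ge0.
Qed.

Lemma distribution_linear (c : C) (u v : Rd -> C) : cbounded u -> cbounded v ->
  distribution_of f (fun x => c * u x + v x) =
  c * distribution_of f u + distribution_of f v.
Proof.
move=> bu bv; rewrite /distribution_of -cintegralZD; [|exact: cintegrableMb..].
by congr cintegral; apply/funext => x; rewrite mulrDr mulrCA.
Qed.

(** The bound on u is asked only on the ball, where f is concentrated. The far estimate relies on
    this with S the whole space; the near one takes for S a cube containing the support of the
    kernel. *)
Lemma distribution_le (u : Rd -> C) (K : R) (S : set Ld) : cmeasurable u ->
  0 <= K -> measurable S ->
  (forall x, B x -> S x -> normc (u x) <= K) ->
  (forall x, ~ S x -> u x = 0) ->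
  ((normc (distribution_of f u))%:E <= (2 * K)%:E * \int[mu]_(x in S) (normc (f x))%:E)%E.
Proof.
move=> mu_ K0 mS uK u0.
have mgS : measurable_fun S (fun x : Ld => (normc (f x))%:E).
  by apply: measurable_funTS; apply/measurable_EFinP; exact: mg.
apply: le_trans (normc_cintegral_le (cmeasurableM mf mu_)) _.
rewrite EFinM -muleA lee_wpmul2l ?lee_fin//.
rewrite -ge0_integralZl_EFin; last 4 first.
- exact: mS.
- by move=> x _; rewrite lee_fin normc_ge0.
- exact: mgS.
- exact: K0.
have mfu : measurable_fun [set: Ld] (fun x => normc (f x * u x)).
  by apply: measurable_normc; exact: cmeasurableM.
rewrite [leRHS]integral_mkcond (@integral_unit_ball (fun x => normc (f x * u x))); last 2 first.
- exact: mfu.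
- by move=> x ->; rewrite mul0r Normc.normc0.
have mR : measurable_fun [set: Ld] ((fun x : Ld => K%:E * (normc (f x))%:E)%E \_ S).
  by apply: (measurable_restrictT _ mS).1; exact: measurable_funeM.
have R0 x : (0 <= ((fun x : Ld => K%:E * (normc (f x))%:E)%E \_ S) x)%E.
  by rewrite patchE; case: ifP => // _; rewrite -EFinM lee_fin mulr_ge0// normc_ge0.
apply: (@le_trans _ _ (\int[mu]_(x in B) ((fun x : Ld => K%:E * (normc (f x))%:E)%E \_ S) x)%E).
  apply: ge0_le_integral; first exact: measurable_unit_ball.
  - by move=> x _; rewrite lee_fin normc_ge0.
  - by apply: measurable_funTS; apply/measurable_EFinP; exact: mfu.
  - exact: measurable_funTS.
  move=> x xB; rewrite patchE Normc.normcM.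
  have [|xS] := boolP (x \in S).
    rewrite inE => xS; rewrite -EFinM lee_fin mulrC.
    by rewrite ler_wpM2r ?normc_ge0// uK.
  rewrite u0 ?Normc.normc0 ?mulr0// => xS'; move/negP: xS; apply.
  by rewrite inE.
apply: ge0_subset_integral.
- exact: measurable_unit_ball.
- exact: measurableT.
- exact: mR.
- by move=> x _; exact: R0.
- by [].
Qed.

Lemma normc_le_seminorm (u : Rd -> C) x :
  ((normc (u x))%:E <= schwartz_seminorm [::] [::] u)%E.
Proof.
apply: ereal_sup_ubound; exists x => //.
by rewrite /monomial big_nil normr1 mul1r /cpderiv /=; case: (u x).
Qed.

Lemma schwartz_cbounded (u : Rd -> C) : schwartz u -> cbounded u.
Proof.
move=> [[sR sI] su]; split.
  by split; apply: continuous_lebesgue_measurable;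
    [have [] := sR [::] | have [] := sI [::]].
have := su [::] [::]; have := normc_le_seminorm u.
case: (schwartz_seminorm _ _ _) => [K uK _| |uK _]; last 1 first.
- by exists 0 => x; have := uK x; rewrite leNgt ltNyr.
- by exists K => x; rewrite -lee_fin.
- by [].
Qed.

(** As f is integrable, the pairing is at most twice its L^1 norm times the sup norm of the test
    function, and the sup norm is the seminorm with both words empty. *)
Lemma tempered_distribution_of : tempered (distribution_of f).
Proof.
split=> [c u v su sv|u_ u su_ su cu].
  by apply: distribution_linear; exact: schwartz_cbounded.
pose v k x := u_ k x - u x.
have mv k : cmeasurable (v k).
  have [[a1 a2] _] := schwartz_cbounded (su_ k).
  have [[b1 b2] _] := schwartz_cbounded su.
  split; [rewrite (_ : (fun x => _) = (fun x : Ld => complex.Re (u_ k x) - complex.Re (u x)))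
         |rewrite (_ : (fun x => _) = (fun x : Ld => complex.Im (u_ k x) - complex.Im (u x)))].
  - exact: measurable_funB.
  - by apply/funext => x; rewrite /v; case: (u_ k x) => ? ?; case: (u x).
  - exact: measurable_funB.
  - by apply/funext => x; rewrite /v; case: (u_ k x) => ? ?; case: (u x).
have Tv k : distribution_of f (u_ k) - distribution_of f u = distribution_of f (v k).
  have bu := schwartz_cbounded su; have buk := schwartz_cbounded (su_ k).
  rewrite (_ : v k = fun x => -1 * u x + u_ k x); last first.
    by apply/funext => x; rewrite mulN1r addrC.
  by rewrite distribution_linear// mulN1r addrC.
pose M := fine (\int[mu]_x (normc (f x))%:E).
have ME : (\int[mu]_x (normc (f x))%:E = M%:E)%E.
  rewrite fineK// ge0_fin_numE ?LloglogL_L1//.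
  by apply: integral_ge0 => x _; rewrite lee_fin normc_ge0.
have /fine_cvgP[sfin scvg] := cu [::] [::].
apply: (@squeeze_cvgr _ _ _ _ (fun=> 0)
   (fun k => (2 * M) * fine (schwartz_seminorm [::] [::] (v k)))).
- near=> k; rewrite normc_ge0 andTb Tv.
  have sk : schwartz_seminorm [::] [::] (v k) \is a fin_num by near: k.
  have vk x : normc (v k x) <= fine (schwartz_seminorm [::] [::] (v k)).
    by rewrite -lee_fin fineK// normc_le_seminorm.
  rewrite -lee_fin mulrAC EFinM -ME.
  apply: (distribution_le (mv k) _ measurableT) => [|x _ _|x /(_ Logic.I)] //.
  by apply: le_trans (vk 0); exact: normc_ge0.
- by apply: cvg_cst.
- rewrite -[X in _ --> X](mulr0 (2 * M)); apply: cvgM; first exact: cvg_cst.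
  exact: scvg.
Unshelve. all: by end_near.
Qed.

End LloglogL_distribution.

(** * Pointwise bounds on the maximal function *)

Section maximal_bounds.
Variables (R : realType) (d : nat).
Local Notation Rd := 'rV[R]_d.
Local Notation Ld := (lebesgue_space R d).
Local Notation C := R[i].
Local Notation mu := (@lebesgue_rV R d).
Local Notation normc := (@Normc.normc R).
Local Notation B := (@unit_ball R d).
Variables (f : Rd -> C) (phi : Rd -> R) (K L : R).
Hypothesis fB : LloglogL B f.
Hypothesis phi_cont : continuous phi.
Hypothesis phi_out : forall x, 1 < `|x| -> phi x = 0.
Hypothesis K0 : 0 <= K.
Hypothesis phiK : forall x, `|phi x| <= K.
Hypothesis L0 : 0 <= L.
Hypothesis phiL : forall x y, `|phi x - phi y| <= L * `|x - y|.

Lemma dilate_continuous (eps : R) (x : Rd) :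
  continuous (fun y : Rd => dilate phi eps (x - y)).
Proof.
move=> y; pose h (z : Rd) : Rd := eps^-1 *: (x - z).
have ch : {for y, continuous h}.
  apply: continuousZl_tmp; apply: continuousB; first exact: cst_continuous.
  by move=> A; apply.
have cphi : {for y, continuous (phi \o h)}.
  by apply: continuous_comp ch _; exact: phi_cont.
by apply: continuousM cphi; exact: cst_continuous.
Qed.

Lemma normr_dilate_le (eps : R) (x : Rd) : 0 < eps ->
  `|dilate phi eps x| <= eps ^- d * K.
Proof.
move=> e0; have ed : 0 <= eps ^- d by rewrite invr_ge0 exprn_ge0// ltW.
by rewrite /dilate normrM (ger0_norm ed) ler_wpM2l.
Qed.

Lemma dilate_cbounded (eps : R) (x : Rd) : 0 < eps ->
  cbounded (fun y => Complex (dilate phi eps (x - y)) 0).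
Proof.
move=> e0; split.
  split; last exact: measurable_cst.
  exact/continuous_lebesgue_measurable/dilate_continuous.
exists (eps ^- d * K) => y; rewrite normc_real normr_dilate_le//.
Qed.

Lemma dilate_out (eps : R) (x : Rd) : 0 < eps -> eps < `|x| -> dilate phi eps x = 0.
Proof.
move=> e0 ex; rewrite /dilate phi_out ?mulr0// normrZ ger0_norm ?invr_ge0 ?ltW//.
by rewrite mulrC ltr_pdivlMr// mul1r.
Qed.

(** The kernel lives on the closed cube of radius eps around x; doubling the radius puts it inside
    an open cube, the shape used in [large_maximalP]. *)
Lemma convolution_le (eps : R) (x : Rd) : 0 < eps ->
  ((normc (convolution (distribution_of f) (dilate phi eps) x))%:E <=
   (2 * (eps ^- d * K))%:E * \int[mu]_(y in ball x (eps *+ 2)) (normc (f y))%:E)%E.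
Proof.
move=> e0; have [mu_ _] := dilate_cbounded x e0.
apply: (distribution_le fB mu_).
- by rewrite mulr_ge0// invr_ge0 exprn_ge0// ltW.
- exact: measurable_lebesgue_ball.
- by move=> y _ _; rewrite normc_real normr_dilate_le.
- move=> y xy; rewrite dilate_out//.
  apply: contra_notT xy; rewrite -leNgt => xy.
  rewrite -ball_normE /= (le_lt_trans xy)// mulr2n ltrDl//.
Qed.

Lemma large_maximal_of_maximal : exists2 A : R, 1 <= A &
  forall s x, 0 <= s -> (s%:E < maximal phi (distribution_of f) x)%E ->
    large_maximal (fun y => normc (f y)) (s / A) x.
Proof.
pose K1 := K + 1; have K10 : 0 < K1 by rewrite ltr_wpDl.
(* The 2 comes from [distribution_le], 12 = 6 * 2 from [large_maximalP] at radius 2 eps, and K + 1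
   in place of K ensures that the constant is at least 1. *)
exists (2 * K1 * 12 ^+ d).
  have : (1 : R) <= 12 ^+ d by rewrite exprn_ege1// ler1n.
  by apply: mulr_ege1; have := K0; rewrite /K1; lra.
move=> s x s0 /ereal_sup_gt[_ [eps /= e0 <-]] lt.
have p12 : (0 : R) < 12 ^+ d by rewrite exprn_gt0.
have pe : 0 < eps ^+ d by rewrite exprn_gt0.
apply: (@large_maximalP _ _ _ _ _ _ (eps *+ 2)).
- by apply: measurable_normc; case: fB => -[].
- by move=> y; exact: normc_ge0.
- by rewrite divr_ge0// !mulr_ge0// ltW.
- by rewrite mulrn_wgt0.
have := lt_le_trans lt (convolution_le x e0).
case: (\int[mu]_(y in _) _)%E (integral_ge0 mu (D := ball x (eps *+ 2)) (f := fun y => (normc (f y))%:E) (fun y _ => normc_ge0 (f y))) => [I| |//]; last by rewrite ltry.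
rewrite -EFinM !lte_fin lee_fin => I0 sI.
rewrite (_ : 6 * (eps *+ 2) = 12 * eps); last by ring.
rewrite exprMn (_ : _ * (_ * _) = s * eps ^+ d / (2 * K1)); last first.
  by field; rewrite !gt_eqF.
rewrite ltr_pdivrMr ?mulr_gt0//.
apply: (@lt_le_trans _ _ (2 * (eps ^- d * K) * I * eps ^+ d)).
  by rewrite ltr_pM2r.
rewrite (_ : 2 * (eps ^- d * K) * I * eps ^+ d = I * (2 * K)); last first.
  by field; rewrite gt_eqF.
by rewrite ler_wpM2l// ler_wpM2l// /K1 lerDl.
Qed.

Hypothesis f0 : cintegral B f = 0.

Lemma distribution_cst0 : distribution_of f (fun=> 1) = 0.
Proof.
rewrite /distribution_of -f0 -(cintegral_unit_ball fB).
by congr cintegral; apply/funext => x; rewrite mulr1.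
Qed.

(** As f has integral zero, phi_eps(x) may be subtracted from the kernel. For y in the ball the
    difference is at most L eps^-(d+1) by the Lipschitz bound. If eps < |x|/2 both values vanish;
    otherwise eps^-(d+1) <= (2/|x|)^(d+1). *)
Lemma maximal_le_far : exists2 A : R, 0 <= A &
  forall x, 2 < `|x| -> (maximal phi (distribution_of f) x <= (A * `|x| ^- d.+1)%:E)%E.
Proof.
pose M := fine (\int[mu]_x (normc (f x))%:E).
have M0 : 0 <= M.
  by apply: fine_ge0; apply: integral_ge0 => x _; rewrite lee_fin normc_ge0.
have ME : (\int[mu]_x (normc (f x))%:E = M%:E)%E.
  rewrite fineK// ge0_fin_numE ?LloglogL_L1//.
  by apply: integral_ge0 => x _; rewrite lee_fin normc_ge0.
exists (2 * (L * 2 ^+ d.+1) * M); first by rewrite !mulr_ge0// exprn_ge0.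
move=> x x2; apply: ge_ereal_sup => _ [eps e0 <-]; have {}e0 : 0 < eps := e0.
have x0 : 0 < `|x| by exact: lt_trans x2.
pose c := dilate phi eps x.
pose u y := Complex (dilate phi eps (x - y)) 0 : C.
pose v y := Complex (dilate phi eps (x - y) - c) 0 : C.
have bu : cbounded u by exact: dilate_cbounded.
have bv : cbounded v.
  have [[mu1 mu2] [H HP]] := bu; split.
    by split; last exact: mu2; apply: measurable_funB; [exact: mu1|exact: measurable_cst].
  exists (H + `|c|) => y; rewrite normc_real (le_trans (ler_normB _ _))// lerD2r.
  by have := HP y; rewrite normc_real.
have b1 : cbounded (fun=> 1 : C).
  split; first by split; exact: measurable_cst.
  by exists 1 => y; rewrite Normc.normc1.
have TE : convolution (distribution_of f) (dilate phi eps) x = distribution_of f v.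
  rewrite /convolution -/u (_ : u = fun y => Complex c 0 * 1 + v y); last first.
    apply/funext => y; rewrite mulr1 /u /v /GRing.add/= addr0.
    by rewrite subrKC.
  by rewrite distribution_linear// distribution_cst0 mulr0 add0r.
rewrite TE.
rewrite (_ : _ * _ * M * _ = 2 * (L * 2 ^+ d.+1 * `|x| ^- d.+1) * M); last by ring.
rewrite EFinM -ME; apply: (distribution_le fB bv.1).
- by rewrite !mulr_ge0// ?invr_ge0 exprn_ge0.
- exact: measurableT.
- move=> y /unit_ball_norm y1 _; rewrite normc_real.
  (* Follows from |y| <= 1 < |x| / 2. *)
  have xy : `|x| / 2 < `|x - y|.
    have := lerB_dist x y; have := x2; lra.
  have [le|lt] := leP (`|x| / 2) eps; last first.
    rewrite /c !dilate_out ?subrr ?normr0//; last 2 first.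
      by rewrite (lt_trans lt)//; lra.
      by rewrite (lt_trans lt).
    by rewrite !mulr_ge0// ?invr_ge0 exprn_ge0.
  have ed : 0 <= eps ^- d by rewrite invr_ge0 exprn_ge0// ltW.
  have e1 : 0 <= eps^-1 by rewrite invr_ge0 ltW.
  rewrite /c /dilate -mulrBr normrM (ger0_norm ed).
  apply: (@le_trans _ _ (eps ^- d * (L * eps^-1))).
    rewrite ler_wpM2l//.
    apply: le_trans (phiL _ _) _; rewrite ler_wpM2l//.
    rewrite -scalerBr addrAC subrr add0r normrZ normrN.
    by rewrite (ger0_norm e1) ler_piMr.
  rewrite mulrCA -invfM -exprSr -mulrA ler_wpM2l//.
  rewrite -[X in _ <= X * _]invrK -invfM lef_pV2 ?posrE ?mulr_gt0 ?invr_gt0 ?exprn_gt0//.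
  rewrite mulrC -exprVn -exprMn lerXn2r ?nnegrE ?divr_ge0 ?(ltW e0)//.
- by move=> y /(_ Logic.I).
Qed.

End maximal_bounds.

(** * Integrating the dominating function *)

(* The integral of a nonnegative function is a supremum over simple functions
   below it, so F, here applied to the maximal function, need not be measurable. *)
Lemma ge0_le_integral_nonmeasurable d (T : measurableType d) (R : realType)
    (mu : {measure set T -> \bar R}) (F G : T -> \bar R) :
  (forall x, 0 <= F x)%E -> (forall x, F x <= G x)%E ->
  (\int[mu]_x F x <= \int[mu]_x G x)%E.
Proof.
move=> F0 FG; have G0 x : (0 <= G x)%E := le_trans (F0 x) (FG x).
rewrite (ge0_integralTE mu F0) (ge0_integralTE mu G0).
apply: ge_ereal_sup => _ [h /= hF <-].
apply: ereal_sup_ubound; exists h => //= x.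
exact: le_trans (FG x).
Qed.

Lemma dyadic_bracket (R : realType) (t : R) : 1 < t ->
  exists k : nat, 2 ^+ k < t /\ t <= 2 ^+ k.+1.
Proof.
move=> t1; have ex : exists n : nat, t <= 2 ^+ n.
  exists (Num.truncn t).+1; apply: (@le_trans _ _ (Num.truncn t).+1%:R).
    by rewrite ltW// truncnS_gt.
  by rewrite -natrX ler_nat ltnW// ltn_expl.
have [[|k] tk mk] := ex_minnP ex; first by move: tk; rewrite expr0 leNgt t1.
exists k; split=> //; rewrite ltNge; apply/negP => /mk.
by rewrite ltnn.
Qed.

Section indicator_series.
Context d (T : measurableType d) (R : realType).
Variables (mu : {measure set T -> \bar R}) (a : nat -> R) (F : nat -> set T).
Hypothesis a0 : forall k, 0 <= a k.
Hypothesis mF : forall k, measurable (F k).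

(** A measurable majorant: its integral involves only the measures of the sets [F k], and membership
    of x in a single one already bounds it below at x. *)
Definition indicator_series (x : T) : \bar R :=
  (\sum_(k <oo) (a k)%:E * (\1_(F k) x)%:E)%E.

Let term0 k x : (0 <= (a k)%:E * (\1_(F k) x)%:E)%E.
Proof. by rewrite -EFinM lee_fin mulr_ge0. Qed.

Let mterm k : measurable_fun setT (fun x => (a k)%:E * (\1_(F k) x)%:E)%E.
Proof. by apply: measurable_funeM; apply/measurable_EFinP; exact: measurable_indic. Qed.

Lemma indicator_series_ge0 x : (0 <= indicator_series x)%E.
Proof. by apply: nneseries_ge0 => k _ _. Qed.

Lemma measurable_indicator_series : measurable_fun setT indicator_series.
Proof. by apply: ge0_emeasurable_sum => // k _; exact: mterm. Qed.

Lemma integral_indicator_series :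
  (\int[mu]_x indicator_series x = \sum_(k <oo) (a k)%:E * mu (F k))%E.
Proof.
rewrite integral_nneseries//; apply: eq_eseriesr => k _.
rewrite ge0_integralZl_EFin//; first by rewrite integral_indic// setIT.
by apply/measurable_EFinP; exact: measurable_indic.
Qed.

Lemma le_indicator_series k x : F k x -> ((a k)%:E <= indicator_series x)%E.
Proof.
move=> Fx; apply: le_trans (nneseries_lim_ge k.+1 (fun n _ _ => term0 n x)).
rewrite big_nat_recr//= indicE mem_set// mule1 leeDr//.
by apply: sume_ge0.
Qed.

(** Meant for the points where the maximal function, and with it [Psi], is infinite. *)
Lemma indicator_series_pinfty x : (forall k, 1 <= a k) -> (forall k, F k x) ->
  indicator_series x = +oo%E.
Proof.
move=> a1 Fx; apply: eq_infty => t.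
apply: le_trans (nneseries_lim_ge (Num.truncn t).+1 (fun n _ _ => term0 n x)).
under eq_bigr do rewrite indicE mem_set// mule1.
rewrite sumEFin lee_fin; apply: (@le_trans _ _ (\sum_(0 <= i < (Num.truncn t).+1) 1)).
  by rewrite big_const_nat subn0 iter_addr_0 ltW// truncnS_gt.
by apply: ler_sum.
Qed.

End indicator_series.

Section Psi_bounds.
Variables (R : realType) (d : nat).
Implicit Type x : 'rV[R]_d.

Lemma ln_expR1D_ge1 (t : R) : 0 <= t -> 1 <= ln (expR 1 + t).
Proof.
move=> t0; rewrite -[leLHS]expRK ler_ln ?posrE ?expR_gt0// ?lerDl//.
by rewrite ltr_pwDl// expR_gt0.
Qed.

Lemma enorm_ge0 x : 0 <= enorm x.
Proof. exact: sqrtr_ge0. Qed.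

Lemma Psi_ge0 x (t : \bar R) : (0 <= t)%E -> (0 <= Psi x t)%E.
Proof.
case: t => [t| |]//=; rewrite !lee_fin => t0.
have := ln_expR1D_ge1 t0; have := ln_expR1D_ge1 (enorm_ge0 x) => ? ?.
by rewrite divr_ge0// addr_ge0//; lra.
Qed.

Lemma Psi_le_id x (t : \bar R) : (0 <= t)%E -> (Psi x t <= t)%E.
Proof.
case: t => [t| |]//=; rewrite !lee_fin => t0.
have := ln_expR1D_ge1 t0; have := ln_expR1D_ge1 (enorm_ge0 x) => ? ?.
rewrite ler_pdivrMr; last lra.
rewrite ler_peMr//; lra.
Qed.

(** Here ln(e + t) >= (k+1) ln 2 while t <= 2 * 2^(k+1), whence the constant 2 / ln 2. *)
Lemma Psi_dyadic x (t : R) (k : nat) : 2 ^+ k.+1 < t -> t <= 2 ^+ k.+2 ->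
  (Psi x t%:E <= (2 / ln 2 * (2 ^+ k.+1 / k.+1%:R))%:E)%E.
Proof.
move=> kt tk; have l2 := ln_2_gt0 R.
have p2 : (0 : R) < 2 ^+ k.+1 by rewrite exprn_gt0.
have t0 : 0 < t by exact: lt_trans kt.
have e0 : (0 : R) < expR 1 by exact: expR_gt0.
have k0 : (0 : R) < k.+1%:R by rewrite ltr0n.
have h1 := ln_expR1D_ge1 (enorm_ge0 x).
have h2 : k.+1%:R * ln 2 <= ln (expR 1 + t).
  rewrite mulr_natl -lnXn// ler_ln ?posrE// ?addr_gt0//; lra.
have k2 : 0 < k.+1%:R * ln (2 : R) by rewrite mulr_gt0.
rewrite /= lee_fin ler_pdivrMr; last lra.
apply: (le_trans tk).
apply: (@le_trans _ _ (2 / ln 2 * (2 ^+ k.+1 / k.+1%:R) * (k.+1%:R * ln 2))).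
  rewrite le_eqVlt; apply/orP; left; apply/eqP; rewrite [in LHS]exprS; field.
  by rewrite !gt_eqF.
rewrite ler_wpM2l//; last lra.
by rewrite !mulr_ge0 ?invr_ge0// ltW.
Qed.

End Psi_bounds.

Theorem theorem2 (R : realType) (d : nat) (d_gt0 : (0 < d)%N)
  (phi : 'rV[R]_d -> R) (c0 : R)
  (phi_smooth : smooth phi)
  (phi_ge0 : forall x, 0 <= phi x)
  (phi_supp : closure [set x | phi x != 0] `<=` @unit_ball R d)
  (phi_int1 : (\int[@lebesgue_rV R d]_x (phi x)%:E = 1)%E)
  (phi_c0 : forall x, enorm x <= 2^-1 -> phi x = c0)
  (f : 'rV[R]_d -> R[i])
  (f_LloglogL : LloglogL (@unit_ball R d) f)
  (f_int0 : cintegral (@unit_ball R d) f = 0) :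
  Hlog phi (distribution_of f).
Proof.
have phi_cont : continuous phi by have [] := phi_smooth [::].
have phi_out x : 1 < `|x| -> phi x = 0.
  move=> x1; apply/eqP; apply: contraTT x1 => phix; rewrite -leNgt.
  by apply: unit_ball_norm; apply: phi_supp; exact: subset_closure.
have [K K0 phiK] := bounded_of_compact_support phi_cont phi_out.
have [L L0 phiL] := smooth_lipschitz phi_smooth phi_out.
split; first exact: tempered_distribution_of f_LloglogL.
have [A1 A11 near] := large_maximal_of_maximal f_LloglogL phi_cont phi_out K0 phiK.
have [A2 A20 far] := maximal_le_far f_LloglogL phi_cont phi_out phiK L0 phiL f_int0.
pose mu := @lebesgue_rV R d.
pose g (x : 'rV[R]_d) := Normc.normc (f x).
have mg : measurable_fun [set: lebesgue_space R d] g.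
  by apply: measurable_normc; case: f_LloglogL => -[].
have g0 x : 0 <= g x by exact: normc_ge0.
pose t x := maximal phi (distribution_of f) x.
have t0 x : (0 <= t x)%E.
  apply: (@le_trans _ _ (Normc.normc (convolution (distribution_of f) (dilate phi 1) x))%:E).
    by rewrite lee_fin; exact: normc_ge0.
  by apply: ereal_sup_ubound; exists 1; first exact: ltr01.
pose a1 (k : nat) : R := 2 ^+ k.+1 / k.+1%:R.
pose F1 (k : nat) : set (lebesgue_space R d) := large_maximal g (2 ^+ k.+1 / A1).
(* If 2^(k+1) < |x| <= 2^(k+2), then |x|^-(d+1) <= [a2 k] and x lies in [F2 k]; the radius 4 *
   2^(k+1) leaves room for the cube to be open. *)
pose a2 (k : nat) : R := (2 ^+ k.+1) ^- d.+1.
pose F2 (k : nat) : set (lebesgue_space R d) := ball (0 : 'rV[R]_d) (2 ^+ k.+1 * 4).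
pose b3 : set (lebesgue_space R d) := ball (0 : 'rV[R]_d) 3.
have a10 k : 0 <= a1 k by rewrite divr_ge0// exprn_ge0.
have a20 k : 0 <= a2 k by rewrite invr_ge0 !exprn_ge0.
have mF1 k : measurable (F1 k) by exact: measurable_large_maximal.
have mF2 k : measurable (F2 k) by exact: measurable_lebesgue_ball.
have mb3 : measurable b3 by exact: measurable_lebesgue_ball.
pose b1 := 2 / ln (2 : R); have b10 : 0 <= b1 by rewrite divr_ge0// ltW// ln_2_gt0.
(* [G0] handles |x| <= 2 with M <= 2, [G1] the larger values of M there, and [G2] the region |x| >
   2. *)
pose G0 (x : lebesgue_space R d) : \bar R := (2%:E * (\1_b3 x)%:E)%E.
pose G1 (x : lebesgue_space R d) : \bar R := (b1%:E * indicator_series a1 F1 x)%E.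
pose G2 (x : lebesgue_space R d) : \bar R := (A2%:E * indicator_series a2 F2 x)%E.
have G00 x : (0 <= G0 x)%E by rewrite /G0 -EFinM lee_fin mulr_ge0.
have G10 x : (0 <= G1 x)%E by rewrite /G1 mule_ge0// indicator_series_ge0.
have G20 x : (0 <= G2 x)%E by rewrite /G2 mule_ge0// indicator_series_ge0.
have dominated x : (Psi x (t x) <= G0 x + (G1 x + G2 x))%E.
  have [x2|x2] := leP `|x| 2; last first.
    have [|k [kx xk]] := @dyadic_bracket R (`|x| / 2); first lra.
    apply: (@le_trans _ _ (G2 x)); last first.
      by rewrite addeA leeDr// adde_ge0.
    apply: le_trans (Psi_le_id _ (t0 x)) _; apply: le_trans (far x x2) _.
    rewrite EFinM lee_wpmul2l ?lee_fin//.
    apply: (@le_trans _ _ (a2 k)%:E).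
      rewrite lee_fin lef_pV2 ?posrE ?exprn_gt0//; last lra.
      rewrite lerXn2r ?nnegrE ?exprn_ge0// exprS; lra.
    apply: le_indicator_series => //.
    rewrite /F2 -ball_normE /= sub0r normrN; move: xk; rewrite exprS.
    have : (0 : R) < 2 ^+ k by rewrite exprn_gt0.
    lra.
  (* At an infinite value x lies in every [F1 k], and each weight [a1 k] is at least 1, so [G1 x] is
     infinite as well. *)
  have := t0 x; case tE : (t x) => [s| |]// => [|_]; last first.
    rewrite [X in (_ <= _ + (X + _))%E](_ : _ = +oo%E); last first.
      rewrite /G1 indicator_series_pinfty//.
      - by rewrite gt0_muley// lte_fin divr_gt0// ln_2_gt0.
      - by move=> k; rewrite /a1 ler_pdivlMr ?ltr0n// mul1r -natrX ler_nat ltnW// ltn_expl.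
      - move=> k; apply: near; first by rewrite exprn_ge0.
        by rewrite -/(t x) tE ltry.
    rewrite addye; last by rewrite -ltNye (lt_le_trans _ (G20 x)).
    by rewrite addey// -ltNye (lt_le_trans _ (G00 x)).
  rewrite lee_fin => s0.
  have [s2|s2] := leP s 2.
    apply: (@le_trans _ _ (G0 x)); last by rewrite leeDl// adde_ge0.
    apply: le_trans (Psi_le_id _ _) _; first by rewrite lee_fin.
    rewrite /G0 indicE mem_set ?mule1 ?lee_fin//.
    rewrite /b3 -ball_normE /= sub0r normrN; lra.
  (* Bracketing s / 2 instead of s makes the lower exponent k + 1 at least 1, so dividing by it is
     harmless. *)
  have [|k [ks sk]] := @dyadic_bracket R (s / 2); first lra.
  have ks1 : 2 ^+ k.+1 < s by rewrite exprS; lra.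
  apply: (@le_trans _ _ (G1 x)); last by rewrite addeCA leeDl// adde_ge0.
  apply: le_trans (Psi_dyadic x ks1 _) _; first by rewrite exprS; lra.
  rewrite EFinM lee_wpmul2l ?lee_fin//; apply: le_indicator_series => //.
  by apply: near; rewrite ?exprn_ge0// -/(t x) tE lte_fin.
have mG1 : measurable_fun setT G1.
  by apply: measurable_funeM; exact: measurable_indicator_series.
have mG2 : measurable_fun setT G2.
  by apply: measurable_funeM; exact: measurable_indicator_series.
have m1 : measurable_fun setT (fun x => (\1_b3 x)%:E : \bar R).
  by apply/measurable_EFinP; exact: measurable_indic.
have mG0 : measurable_fun setT G0 by apply: measurable_funeM; exact: m1.
apply: le_lt_trans (ge0_le_integral_nonmeasurable mu (fun x => Psi_ge0 x (t0 x)) dominated) _.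
rewrite ge0_integralD; [|exact: measurableT|by []|exact: mG0|by move=> x _; rewrite adde_ge0
  |exact: emeasurable_funD].
rewrite lte_add_pinfty//.
  rewrite ge0_integralZl_EFin; [|exact: measurableT|by []|exact: m1|by []].
  rewrite integral_indic; [|exact: measurableT|exact: mb3].
  rewrite setIT [X in (_ * X)%E](_ : _ = ((3 *+ 2) ^+ d)%:E).
    by rewrite -EFinM ltry.
  exact: lebesgue_rV_ball.
rewrite ge0_integralD; [|exact: measurableT|by []|exact: mG1|by []|exact: mG2].
rewrite lte_add_pinfty//.
  rewrite ge0_integralZl_EFin; [|exact: measurableT
    |by move=> x _; exact: indicator_series_ge0|exact: measurable_indicator_series|exact: b10].
  rewrite lte_mul_pinfty// integral_indicator_series//.
  apply: sum_large_maximal_lty => //.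
  - exact: LloglogL_L1 f_LloglogL.
  - exact: LloglogL_loglog f_LloglogL.
rewrite ge0_integralZl_EFin; [|exact: measurableT
  |by move=> x _; exact: indicator_series_ge0|exact: measurable_indicator_series|exact: A20].
rewrite lte_mul_pinfty// integral_indicator_series//.
(* The k-th cube has volume (8 * 2^(k+1))^d, so its term is 8^d / 2^(k+1) and the geometric series
   is bounded by 8^d. *)
have := @epsilon_trick0 R (8 ^+ d) xpredT; rewrite exprn_ge0// => /(_ isT) le8.
apply: le_lt_trans (ltry (8 ^+ d : R)); apply: le_trans le8.
apply: lee_nneseries => k _; first by move=> _; rewrite mule_ge0// lee_fin.
have p2 : (0 : R) < 2 ^+ k.+1 by rewrite exprn_gt0.
rewrite [X in (_ * X)%E](_ : _ = ((2 ^+ k.+1 * 4 *+ 2) ^+ d)%:E); last first.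
  by apply: lebesgue_rV_ball; rewrite mulr_gt0.
rewrite -EFinM lee_fin /a2 natrX; move: (2 ^+ k.+1) p2 => p p0.
rewrite (_ : p * 4 *+ 2 = 8 * p); last by ring.
rewrite exprMn exprS le_eqVlt; apply/orP; left; apply/eqP; field.
by rewrite !gt_eqF// exprn_gt0.
Qed.
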